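(* Let $n\ge 2$ and let $\mathbf{p}=(\mathbf{p}_1,\dots,\mathbf{p}_N)$ be any configuration of points in $\mathbb{E}^n$. Then, as $r\to\infty$, $$\mathrm{Vol}_n\Big[\bigcap_{i=1}^N B_n(\mathbf{p}_i,r)\Big]=\delta_n r^n - M_n[\mathrm{Conv}\{\mathbf{p}_1,\dots,\mathbf{p}_N\}]\,r^{n-1}+o(r^{n-1}),$$ where $\delta_n=\mathrm{Vol}_n[B_n(0,1)]$.
   Context: $B_n(\mathbf{x},r)$ is the closed ball of radius $r$ centered at $\mathbf{x}$; $\mathrm{Vol}_n$ is $n$-dimensional volume; $\mathrm{Conv}$ is convex hull. For a compact convex $K\subset\mathbb{E}^n$, $M_n[K]=\int_{S^{n-1}}\max\{\langle x,u\rangle: x\in K\}\,d\sigma(u)$, with $\sigma$ the Lebesgue surface measure on the unit sphere $S^{n-1}$. *)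

(* Defs.v *)
From Stdlib Require Import Reals Lra Lia ZArith List Classical ClassicalEpsilon.
Open Scope R_scope.

(* Points of E^n: only the coordinates 0..n-1 of a (nat -> R) are used. *)
Definition vec := nat -> R.

Definition sumR (l : list R) : R := fold_right Rplus 0 l.

Definition sum_lt (n : nat) (f : nat -> R) : R := sumR (map f (seq 0 n)).

Definition dot (n : nat) (x y : vec) : R := sum_lt n (fun i => x i * y i).
Definition norm (n : nat) (x : vec) : R := sqrt (dot n x x).

Definition ball (n : nat) (c : vec) (r : R) : vec -> Prop :=
  fun x => norm n (fun i => x i - c i) <= r.

Definition indic (S : vec -> Prop) (x : vec) : R :=
  if excluded_middle_informative (S x) then 1 else 0.

Fixpoint grid_sum (d : nat) (m : nat) (g : (nat -> Z) -> R) : R :=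
  match d with
  | O => g (fun _ => 0%Z)
  | S d' => sumR (map (fun j : nat =>
              grid_sum d' m (fun z => g (fun i => if Nat.eqb i d'
                                                 then (Z.of_nat j - Z.of_nat m)%Z
                                                 else z i)))
              (seq 0 (2 * m)))
  end.

(* Riemann sum of f over the dyadic grid of mesh 2^-k, cube-centre samples,
   restricted to the box [-k, k)^n *)
Definition riemann_sum (n : nat) (f : vec -> R) (k : nat) : R :=
  (/ 2 ^ k) ^ n *
  grid_sum n (k * 2 ^ k) (fun z => f (fun i => (IZR (z i) + / 2) / 2 ^ k)).

Definition has_integral (n : nat) (f : vec -> R) (L : R) : Prop :=
  Un_cv (fun k => riemann_sum n f k) L.

Definition is_volume (n : nat) (S : vec -> Prop) (v : R) : Prop :=
  has_integral n (indic S) v.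

(* integral over S^{n-1} w.r.t. Lebesgue surface measure sigma, via the
   cone formula  int_{S^{n-1}} f dsigma = n * int_{B_n(0,1)} f(x/|x|) dx *)
Definition has_sphere_integral (n : nat) (f : vec -> R) (L : R) : Prop :=
  has_integral n
    (fun x => if excluded_middle_informative (0 < norm n x <= 1)
              then INR n * f (fun i => x i / norm n x) else 0) L.

Definition conv (n N : nat) (p : nat -> vec) : vec -> Prop :=
  fun x => exists lam : nat -> R,
    (forall i, (i < N)%nat -> 0 <= lam i) /\
    sum_lt N lam = 1 /\
    forall j, (j < n)%nat -> x j = sum_lt N (fun i => lam i * p i j).

Definition is_support_value (n : nat) (K : vec -> Prop) (u : vec) (h : R) : Prop :=
  is_lub (fun t => exists x, K x /\ t = dot n x u) h.

Definition is_Mn (n : nat) (K : vec -> Prop) (M : R) : Prop :=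
  exists h : vec -> R,
    (forall u, is_support_value n K u (h u)) /\ has_sphere_integral n h M.

Definition zero_vec : vec := fun _ => 0.

Definition inter_balls (n N : nat) (p : nat -> vec) (r : R) : vec -> Prop :=
  fun x => forall i, (i < N)%nat -> ball n (p i) r x.

(* Main.v *)
(* The intersection [A_r] of the balls of radius [r] is squeezed, up to an [o(1)] change of radius,
   between star bodies [|x| + h(-x/|x|) <= r], where [h] is the support function of the hull:
   one inclusion is Cauchy-Schwarz, the other an expansion of [|x - p_i|^2]. A partition of unity
   [phi_j] in the values of the direction function [h(-x/|x|)], with nodes [a_j], turns this into
     [sum_j phi_j 1_{|x| <= r - a_j - 3 eta} <= 1_{A_r} <= sum_j phi_j 1_{|x| <= r - a_j}].
   Since [phi_j] is homogeneous of degree 0, the integrals of the two sides are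
   [sum_j c_j (r - a_j - 3 eta)^n] and [sum_j c_j (r - a_j)^n] with [c_j] the integral of [phi_j]
   over the unit ball; expanding the powers gives the claim.

   Integrals are handled by sandwiching between Lipschitz functions of compact support, for which
   the dyadic Riemann sums converge to an iterated Riemann integral, and the latter obeys the
   linear change of variables in each coordinate. *)
From Stdlib Require Import Reals Lra Lia ZArith List.
From Stdlib Require Import Classical ClassicalEpsilon FunctionalExtensionality.
From Coquelicot Require Import Rcomplements Hierarchy RInt.
Require Import Defs.
Open Scope R_scope.

(** Scaling takes the place of polar coordinates: once the values of the direction function are
    discretized, the radius is constant on each piece and only dilations of one integral over the
    unit ball are needed. The obstacle is that [has_integral] samples one fixed grid, from which
    invariance under dilations cannot be read off; hence the detour through Lipschitz bounds.
    Functions of the direction jump at the origin and indicators of balls jump at the sphere; in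
    both cases the defect is dominated by a rescaled cutoff, or by the difference of a cutoff and
    its rescaled copy, so its integral is known by homogeneity. The shift [3 eta] consists of
    [2 eta], the width of the support of a weight, and [eta], the loss in the inner inclusion. The
    factor n of the linear term comes from expanding the power on one side and from the cone formula
    on the other, and the reflection of x removes the sign in h(-x/|x|). *)

Lemma INR_2 : INR 2 = 2.
Proof. simpl. ring. Qed.

(** * Finite sums *)

Lemma sum_lt_S n f : sum_lt (S n) f = sum_lt n f + f n.
Proof.
  unfold sum_lt. rewrite seq_S, map_app. simpl.
  generalize (map f (seq 0 n)). intros l. induction l; simpl.
  - ring.
  - rewrite IHl. ring.
Qed.

Lemma sum_lt_ext n f g : (forall i, (i < n)%nat -> f i = g i) -> sum_lt n f = sum_lt n g.
Proof.
  induction n; intros H; [reflexivity|].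
  rewrite !sum_lt_S, IHn, (H n) by auto. reflexivity.
Qed.

Lemma sum_lt_le n f g : (forall i, (i < n)%nat -> f i <= g i) -> sum_lt n f <= sum_lt n g.
Proof.
  induction n; intros H; [apply Rle_refl|].
  rewrite !sum_lt_S. apply Rplus_le_compat; auto.
Qed.

Lemma sum_lt_plus n f g : sum_lt n (fun i => f i + g i) = sum_lt n f + sum_lt n g.
Proof. induction n; [cbn; ring|]. rewrite !sum_lt_S, IHn. ring. Qed.

Lemma sum_lt_scal n c f : sum_lt n (fun i => c * f i) = c * sum_lt n f.
Proof. induction n; [cbn; ring|]. rewrite !sum_lt_S, IHn. ring. Qed.

Lemma sum_lt_const n c : sum_lt n (fun _ => c) = INR n * c.
Proof. induction n; [cbn; ring|]. rewrite sum_lt_S, IHn, S_INR. ring. Qed.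

Lemma sum_lt_0 n : sum_lt n (fun _ => 0) = 0.
Proof. rewrite sum_lt_const. ring. Qed.

Lemma sum_lt_nonneg n f : (forall i, (i < n)%nat -> 0 <= f i) -> 0 <= sum_lt n f.
Proof. intros H. rewrite <- (sum_lt_0 n). apply sum_lt_le, H. Qed.

Lemma sum_lt_Rabs n f : Rabs (sum_lt n f) <= sum_lt n (fun i => Rabs (f i)).
Proof.
  induction n; [cbn; rewrite Rabs_R0; apply Rle_refl|].
  rewrite !sum_lt_S. eapply Rle_trans; [apply Rabs_triang|]. lra.
Qed.

Lemma sum_lt_term_le n f i :
  (forall j, (j < n)%nat -> 0 <= f j) -> (i < n)%nat -> f i <= sum_lt n f.
Proof.
  induction n; intros H Hi; [lia|]. rewrite sum_lt_S.
  assert (H0 : 0 <= f n) by auto.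
  destruct (Nat.eq_dec i n) as [->|Hne].
  - assert (0 <= sum_lt n f) by (apply sum_lt_nonneg; auto). lra.
  - assert (f i <= sum_lt n f) by (apply IHn; auto; lia). lra.
Qed.

Lemma sum_lt_telescope n f : sum_lt n (fun j => f j - f (S j)) = f 0%nat - f n.
Proof. induction n; [cbn; ring|]. rewrite sum_lt_S, IHn. ring. Qed.

(** * Lipschitz functions and iterated integrals *)

(** The l1 distance is additive over coordinates, so changing one coordinate contributes exactly one
    term. This keeps the Lipschitz constant unchanged when passing to slices. *)
Definition l1dist (n : nat) (x y : vec) : R := sum_lt n (fun i => Rabs (x i - y i)).

(* In particular [f] depends only on the coordinates below [n]. *)
Definition lipschitz (n : nat) (L : R) (f : vec -> R) : Prop :=
  forall x y, Rabs (f x - f y) <= L * l1dist n x y.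

Definition supported_in (n : nat) (lo hi : vec) (f : vec -> R) : Prop :=
  forall x i, (i < n)%nat -> x i < lo i \/ hi i < x i -> f x = 0.

Definition upd (x : vec) (d : nat) (t : R) : vec := fun i => if Nat.eqb i d then t else x i.

(** The last coordinate is the outermost one, as in [grid_sum], so that both recursions can be
    compared level by level. *)
Fixpoint iter_int (d : nat) (lo hi : vec) (f : vec -> R) : R :=
  match d with
  | O => f zero_vec
  | S d' => RInt (fun t => iter_int d' lo hi (fun x => f (upd x d' t))) (lo d') (hi d')
  end.

Fixpoint box_vol (d : nat) (lo hi : vec) : R :=
  match d with
  | O => 1
  | S d' => box_vol d' lo hi * (hi d' - lo d')
  end.

Lemma l1dist_nonneg n x y : 0 <= l1dist n x y.
Proof. apply sum_lt_nonneg. intros. apply Rabs_pos. Qed.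

Lemma upd_same x d t : upd x d t d = t.
Proof. unfold upd. now rewrite Nat.eqb_refl. Qed.

Lemma upd_lt x d t i : (i < d)%nat -> upd x d t i = x i.
Proof. intros H. unfold upd. destruct (Nat.eqb_spec i d); [lia|reflexivity]. Qed.

Lemma l1dist_upd d x y s t : l1dist (S d) (upd x d s) (upd y d t) = l1dist d x y + Rabs (s - t).
Proof.
  unfold l1dist. rewrite sum_lt_S, !upd_same. f_equal.
  apply sum_lt_ext. intros i Hi. now rewrite !upd_lt.
Qed.

Lemma l1dist_self n x : l1dist n x x = 0.
Proof.
  unfold l1dist. rewrite <- (sum_lt_0 n). apply sum_lt_ext.
  intros. rewrite Rminus_diag. apply Rabs_R0.
Qed.

Lemma lipschitz_upd d L f t : lipschitz (S d) L f -> lipschitz d L (fun x => f (upd x d t)).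
Proof.
  intros H x y. eapply Rle_trans; [apply H|].
  rewrite l1dist_upd, Rminus_diag, Rabs_R0, Rplus_0_r. apply Rle_refl.
Qed.

Lemma lipschitz_upd_val d L f x s t :
  lipschitz (S d) L f -> Rabs (f (upd x d s) - f (upd x d t)) <= L * Rabs (s - t).
Proof.
  intros H. eapply Rle_trans; [apply H|].
  rewrite l1dist_upd, l1dist_self, Rplus_0_l. apply Rle_refl.
Qed.

Lemma lipschitz_ex_RInt (F : R -> R) C a b :
  (forall s t, Rabs (F s - F t) <= C * Rabs (s - t)) -> ex_RInt F a b.
Proof.
  intros H. apply (ex_RInt_continuous (V := R_CompleteNormedModule)). intros z _.
  apply continuity_pt_filterlim. intros e He.
  assert (HC : 0 < Rabs C + 1) by (generalize (Rabs_pos C); lra).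
  exists (e / (Rabs C + 1)). split.
  - apply Rdiv_lt_0_compat; lra.
  - intros x [_ Hx]. simpl in *. unfold R_dist in *.
    eapply Rle_lt_trans; [apply H|].
    eapply Rle_lt_trans; [apply Rmult_le_compat_r; [apply Rabs_pos|]|].
    + apply Rle_trans with (Rabs C + 1); [generalize (Rle_abs C); lra|apply Rle_refl].
    + apply Rmult_lt_compat_l with (r := Rabs C + 1) in Hx; [|assumption].
      replace ((Rabs C + 1) * (e / (Rabs C + 1))) with e in Hx by (field; lra). exact Hx.
Qed.

Lemma RInt_dist_le (F G : R -> R) a b B :
  a <= b -> ex_RInt F a b -> ex_RInt G a b ->
  (forall t, a <= t <= b -> Rabs (F t - G t) <= B) ->
  Rabs (RInt F a b - RInt G a b) <= (b - a) * B.
Proof.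
  intros Hab HF HG H.
  change (RInt F a b - RInt G a b) with (minus (RInt F a b) (RInt G a b)).
  rewrite <- RInt_minus by assumption.
  apply abs_RInt_le_const; [assumption| |assumption].
  apply (ex_RInt_minus F G); assumption.
Qed.

(** Integrability of the slices comes out of the same induction: the bound in dimension [d], applied
    to two slices of one function, makes the slice integral Lipschitz in its parameter, and this is
    what the outer integral requires. *)
Lemma iter_int_dist_le d : forall lo hi f g L L' B,
  (forall i, lo i <= hi i) -> lipschitz d L f -> lipschitz d L' g ->
  (forall x, Rabs (f x - g x) <= B) ->
  Rabs (iter_int d lo hi f - iter_int d lo hi g) <= B * box_vol d lo hi.
Proof.
  induction d; intros lo hi f g L L' B Hlh Hf Hg H; simpl.
  - rewrite Rmult_1_r. apply H.
  - assert (E : forall f L, lipschitz (S d) L f -> forall a b,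
      ex_RInt (fun t => iter_int d lo hi (fun x => f (upd x d t))) a b).
    { intros k K Hk a b. apply lipschitz_ex_RInt with (K * box_vol d lo hi).
      intros s t. replace (K * box_vol d lo hi * Rabs (s - t)) with
        (K * Rabs (s - t) * box_vol d lo hi) by ring.
      apply (IHd lo hi _ _ K K); auto using lipschitz_upd.
      intros x. now apply lipschitz_upd_val. }
    eapply Rle_trans.
    + apply RInt_dist_le with (B := B * box_vol d lo hi); eauto.
      intros t _. apply (IHd lo hi _ _ L L'); auto using lipschitz_upd.
    + right. ring.
Qed.

Lemma iter_int_slice_lipschitz d lo hi f L s t :
  (forall i, lo i <= hi i) -> lipschitz (S d) L f ->
  Rabs (iter_int d lo hi (fun x => f (upd x d s)) - iter_int d lo hi (fun x => f (upd x d t)))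
  <= L * box_vol d lo hi * Rabs (s - t).
Proof.
  intros H Hf.
  replace (L * box_vol d lo hi * Rabs (s - t)) with (L * Rabs (s - t) * box_vol d lo hi) by ring.
  apply (iter_int_dist_le d lo hi _ _ L L); auto using lipschitz_upd.
  intros x. now apply lipschitz_upd_val.
Qed.

Lemma iter_int_slice_ex_RInt d lo hi f L a b :
  (forall i, lo i <= hi i) -> lipschitz (S d) L f ->
  ex_RInt (fun t => iter_int d lo hi (fun x => f (upd x d t))) a b.
Proof.
  intros H Hf. apply lipschitz_ex_RInt with (L * box_vol d lo hi).
  intros. now apply iter_int_slice_lipschitz.
Qed.

Lemma iter_int_zero d : forall lo hi f, (forall x, f x = 0) -> iter_int d lo hi f = 0.
Proof.
  induction d; intros lo hi f H; simpl; [apply H|].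
  rewrite (RInt_ext _ (fun _ => 0)).
  - rewrite RInt_const. unfold scal; simpl; unfold mult; simpl. ring.
  - intros t _. apply IHd. auto.
Qed.

(** The outer interval splits into three; on the two end pieces the slices vanish identically. This
    lets the growing boxes of the Riemann sums be compared with one fixed box. *)
Lemma iter_int_shrink_box d : forall lo hi lo' hi' f L,
  (forall i, lo i <= lo' i <= hi' i) -> (forall i, hi' i <= hi i) ->
  lipschitz d L f -> supported_in d lo' hi' f ->
  iter_int d lo hi f = iter_int d lo' hi' f.
Proof.
  induction d; intros lo hi lo' hi' f L Hlo Hhi HL HS; simpl; [reflexivity|].
  assert (Hb : forall i, lo i <= hi i) by (intros i; specialize (Hlo i); specialize (Hhi i); lra).
  assert (E := fun a b => iter_int_slice_ex_RInt d lo hi f L a b Hb HL).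
  assert (Z : forall t, t < lo' d \/ hi' d < t ->
    iter_int d lo hi (fun x => f (upd x d t)) = 0).
  { intros t Ht. apply iter_int_zero. intros x. apply (HS _ d); [lia|].
    now rewrite upd_same. }
  assert (Z' : forall a b, a <= b -> (forall t, a < t < b -> t < lo' d \/ hi' d < t) ->
    RInt (fun t => iter_int d lo hi (fun x => f (upd x d t))) a b = 0).
  { intros a b Hab Ht. rewrite (RInt_ext _ (fun _ => 0)).
    - rewrite RInt_const. unfold scal; simpl; unfold mult; simpl. ring.
    - intros t. rewrite Rmin_left, Rmax_right by assumption. auto. }
  specialize (Hlo d) as Hlod. specialize (Hhi d) as Hhid.
  rewrite <- (RInt_Chasles _ (lo d) (lo' d)) by auto.
  rewrite <- (RInt_Chasles _ (lo' d) (hi' d) (hi d)) by auto.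
  rewrite (Z' (lo d) (lo' d)) by (auto; lra || (intros; lra)).
  rewrite (Z' (hi' d) (hi d)) by (auto; lra || (intros; lra)).
  unfold plus; simpl. rewrite Rplus_0_l, Rplus_0_r.
  apply RInt_ext. intros t _. apply (IHd _ _ _ _ _ L); auto using lipschitz_upd.
  intros x i Hi Hx. apply (HS _ i); [lia|]. now rewrite upd_lt.
Qed.

Lemma RInt_scal_comp_lin (F : R -> R) c a b lo hi :
  ex_RInt F (a * lo + b) (a * hi + b) ->
  RInt (fun t => c * (a * F (a * t + b))) lo hi = c * RInt F (a * lo + b) (a * hi + b).
Proof.
  intros H. rewrite <- (RInt_comp_lin F a b lo hi H).
  apply (RInt_scal (V := R_CompleteNormedModule)).
  now apply (ex_RInt_comp_lin F a b lo hi).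
Qed.

Lemma RInt_reflect (F : R -> R) lo hi :
  ex_RInt F (- hi) (- lo) -> RInt (fun t => F (- t)) lo hi = RInt F (- hi) (- lo).
Proof.
  intros H. apply ex_RInt_swap in H.
  rewrite <- (opp_RInt_swap F (- lo) (- hi) H).
  replace (- lo) with (-1 * lo + 0) in * by ring.
  replace (- hi) with (-1 * hi + 0) in * by ring.
  transitivity (-1 * RInt F (-1 * lo + 0) (-1 * hi + 0)).
  - rewrite <- RInt_scal_comp_lin by exact H.
    apply RInt_ext. intros t _. replace (-1 * t + 0) with (- t) by ring.
    change (@eq R (F (- t)) (-1 * (-1 * F (- t)))). ring.
  - unfold opp; simpl. ring.
Qed.

(** A common dilation factor with an arbitrary translation: enough to carry the unit ball to any
    ball of positive radius. *)
Definition affine (a : R) (b x : vec) : vec := fun i => a * x i + b i.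

Lemma iter_int_ext d lo hi f g :
  (forall x, f x = g x) -> iter_int d lo hi f = iter_int d lo hi g.
Proof. intros H. f_equal. now apply functional_extensionality. Qed.

Lemma affine_upd a b x d t : affine a b (upd x d t) = upd (affine a b x) d (a * t + b d).
Proof.
  apply functional_extensionality. intros i. unfold affine, upd.
  destruct (Nat.eqb_spec i d); now subst.
Qed.

Lemma iter_int_affine d : forall a b lo hi f L,
  0 < a -> (forall i, lo i <= hi i) -> lipschitz d L f ->
  iter_int d lo hi (fun x => f (affine a b x)) =
  (/ a) ^ d * iter_int d (affine a b lo) (affine a b hi) f.
Proof.
  induction d; intros a b lo hi f L Ha Hlh HL; simpl.
  (* In dimension 0 the distance is always 0, so the Lipschitz bound forces [f] to be constant and
     the translation of the base point does not matter. *)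
  - rewrite Rmult_1_l. apply Rminus_diag_uniq.
    specialize (HL (affine a b zero_vec) zero_vec).
    cbn in HL. rewrite Rmult_0_r in HL.
    generalize (Rabs_pos (f (affine a b zero_vec) - f zero_vec)). intros HP.
    destruct (Req_dec (f (affine a b zero_vec) - f zero_vec) 0) as [E|E]; [assumption|].
    generalize (Rabs_pos_lt _ E). lra.
  - assert (Hab : forall i, affine a b lo i <= affine a b hi i).
    { intros i. unfold affine. specialize (Hlh i). nra. }
    set (F := fun t => iter_int d (affine a b lo) (affine a b hi) (fun x => f (upd x d t))).
    assert (EF : forall u v, ex_RInt F u v).
    { intros. now apply (iter_int_slice_ex_RInt d _ _ f L). }
    rewrite (RInt_ext _ (fun t => (/ a) ^ S d * (a * F (a * t + b d)))).
    + now rewrite RInt_scal_comp_lin.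
    + intros t _. rewrite (iter_int_ext _ _ _ _ (fun x => f (upd (affine a b x) d (a * t + b d))))
        by (intros; now rewrite affine_upd).
      rewrite (IHd a b lo hi (fun x => f (upd x d (a * t + b d))) L) by auto using lipschitz_upd.
      unfold F. simpl. field. lra.
Qed.

Definition opp_vec (x : vec) : vec := fun i => - x i.

Lemma opp_vec_upd x d t : opp_vec (upd x d t) = upd (opp_vec x) d (- t).
Proof.
  apply functional_extensionality. intros i. unfold opp_vec, upd.
  destruct (Nat.eqb_spec i d); now subst.
Qed.

(** The factor -1 exchanges the two ends of each interval, hence a separate treatment from
    [iter_int_affine], where the factor is positive. *)
Lemma iter_int_opp d : forall lo hi f L,
  (forall i, lo i <= hi i) -> lipschitz d L f ->
  iter_int d lo hi (fun x => f (opp_vec x)) = iter_int d (opp_vec hi) (opp_vec lo) f.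
Proof.
  induction d; intros lo hi f L Hlh HL; simpl.
  - f_equal. apply functional_extensionality. intros i. unfold opp_vec, zero_vec. ring.
  - assert (Hab : forall i, opp_vec hi i <= opp_vec lo i).
    { intros i. unfold opp_vec. specialize (Hlh i). lra. }
    set (F := fun t => iter_int d (opp_vec hi) (opp_vec lo) (fun x => f (upd x d t))).
    assert (EF : forall u v, ex_RInt F u v).
    { intros. now apply (iter_int_slice_ex_RInt d _ _ f L). }
    rewrite (RInt_ext _ (fun t => F (- t))).
    + now rewrite RInt_reflect.
    + intros t _. rewrite (iter_int_ext _ _ _ _ (fun x => f (upd (opp_vec x) d (- t))))
        by (intros; now rewrite opp_vec_upd).
      rewrite (IHd lo hi (fun x => f (upd x d (- t))) L) by auto using lipschitz_upd.
      reflexivity.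
Qed.

(** * Convergence of the dyadic Riemann sums *)

Definition mid (k : nat) (z : Z) : R := (IZR z + / 2) / 2 ^ k.

(** On a cell of width [h] the function stays within [C * h] of its midpoint value, so each cell
    costs at most [C * (h * h)]; no smoothness beyond Lipschitz is used. *)
Lemma midpoint_rule (F : R -> R) C a h q :
  0 <= h -> (forall s t, Rabs (F s - F t) <= C * Rabs (s - t)) ->
  Rabs (sum_lt q (fun j => h * F (a + (INR j + / 2) * h)) - RInt F a (a + INR q * h))
  <= INR q * (C * (h * h)).
Proof.
  intros Hh HF.
  assert (E := fun u v => lipschitz_ex_RInt F C u v HF).
  assert (HC : 0 <= C).
  { specialize (HF 1 0). rewrite Rminus_0_r, Rabs_R1 in HF.
    generalize (Rabs_pos (F 1 - F 0)). lra. }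
  induction q.
  - simpl. rewrite !Rmult_0_l, Rplus_0_r, RInt_point. unfold zero; simpl.
    unfold sum_lt; simpl. rewrite Rminus_0_r, Rabs_R0. lra.
  - rewrite sum_lt_S, <- (RInt_Chasles F a (a + INR q * h)) by auto.
    match goal with |- context [plus ?u ?v] => change (plus u v) with (u + v) end.
    assert (H : Rabs (h * F (a + (INR q + / 2) * h)
      - RInt F (a + INR q * h) (a + INR (S q) * h)) <= C * (h * h)).
    { replace (h * F (a + (INR q + / 2) * h)) with
        (RInt (fun _ => F (a + (INR q + / 2) * h)) (a + INR q * h) (a + INR (S q) * h)).
      2:{ rewrite RInt_const, S_INR. unfold scal; simpl; unfold mult; simpl.
          ring. }
      eapply Rle_trans.
      - apply RInt_dist_le with (B := C * h); auto.
        + rewrite S_INR. nra.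
        + apply ex_RInt_const.
        + intros t Ht. eapply Rle_trans; [apply HF|].
          apply Rmult_le_compat_l; [assumption|].
          rewrite S_INR in Ht. apply Rabs_le. nra.
      - rewrite S_INR. right. ring. }
    set (X := sum_lt _ _) in *.
    set (Y := h * F _) in *.
    set (Z := RInt F a (a + INR q * h)) in *.
    set (W := RInt F (a + INR q * h) (a + INR (S q) * h)) in *.
    replace (X + Y - (Z + W)) with ((X - Z) + (Y - W)) by ring.
    eapply Rle_trans; [apply Rabs_triang|]. rewrite (S_INR q). lra.
Qed.

Lemma grid_sum_ext d : forall m g g', (forall z, g z = g' z) -> grid_sum d m g = grid_sum d m g'.
Proof. intros m g g' H. f_equal. now apply functional_extensionality. Qed.

Lemma grid_sum_S d m g :
  grid_sum (S d) m g = sum_lt (2 * m) (fun j => grid_sum d m (fun z => g (fun i =>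
    if Nat.eqb i d then (Z.of_nat j - Z.of_nat m)%Z else z i))).
Proof. reflexivity. Qed.

Lemma grid_sum_le d : forall m g g', (forall z, g z <= g' z) -> grid_sum d m g <= grid_sum d m g'.
Proof.
  induction d; intros m g g' H; [apply H|].
  rewrite !grid_sum_S. apply sum_lt_le. intros i _. apply IHd. auto.
Qed.

Lemma grid_sum_plus d : forall m g g',
  grid_sum d m (fun z => g z + g' z) = grid_sum d m g + grid_sum d m g'.
Proof.
  induction d; intros m g g'; [reflexivity|].
  rewrite !grid_sum_S, <- sum_lt_plus. apply sum_lt_ext. intros i _. apply IHd.
Qed.

Lemma grid_sum_scal d : forall m c g,
  grid_sum d m (fun z => c * g z) = c * grid_sum d m g.
Proof.
  induction d; intros m c g; [reflexivity|].
  rewrite !grid_sum_S, <- sum_lt_scal. apply sum_lt_ext. intros i _. apply IHd.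
Qed.

Definition const_vec (c : R) : vec := fun _ => c.

Lemma box_vol_const d a b : box_vol d (const_vec a) (const_vec b) = (b - a) ^ d.
Proof. induction d; simpl; [reflexivity|]. rewrite IHd. unfold const_vec. ring. Qed.

Lemma mid_upd k z d w :
  (fun i => (IZR (if Nat.eqb i d then w else z i) + / 2) / 2 ^ k)
  = upd (fun i => (IZR (z i) + / 2) / 2 ^ k) d (mid k w).
Proof.
  apply functional_extensionality. intros i. unfold upd, mid.
  now destruct (Nat.eqb i d).
Qed.

Lemma riemann_sum_S d f k :
  riemann_sum (S d) f k =
  sum_lt (2 * (k * 2 ^ k)) (fun j =>
    / 2 ^ k * riemann_sum d (fun x => f (upd x d (mid k (Z.of_nat j - Z.of_nat (k * 2 ^ k))))) k).
Proof.
  unfold riemann_sum. rewrite grid_sum_S.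
  rewrite <- sum_lt_scal. apply sum_lt_ext. intros j _.
  rewrite <- Rmult_assoc. f_equal.
  apply grid_sum_ext. intros z. now rewrite mid_upd.
Qed.

(** Coordinates are replaced one at a time, each at the same cost, which gives the factor [INR d].
    The power of [2 * INR k] is the volume of the sampled box, which grows with [k]; the mesh
    [/ 2 ^ k] will beat it. *)
Lemma riemann_sum_iter_int d : forall f L k,
  0 <= L -> lipschitz d L f ->
  Rabs (riemann_sum d f k - iter_int d (const_vec (- INR k)) (const_vec (INR k)) f)
  <= INR d * (L * (2 * INR k) ^ d * / 2 ^ k).
Proof.
  induction d; intros f L k HL Hf.
  - unfold riemann_sum. simpl. rewrite Rmult_1_l, Rmult_0_l.
    specialize (Hf (fun i => (0 + / 2) / 2 ^ k) zero_vec). cbn in Hf. lra.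
  - set (h := / 2 ^ k). set (lo := const_vec (- INR k)). set (hi := const_vec (INR k)).
    assert (Hk := pos_INR k).
    assert (H2 : 0 < 2 ^ k) by (apply pow_lt; lra).
    assert (Hh : 0 < h) by now apply Rinv_0_lt_compat.
    assert (Hlh : forall i, lo i <= hi i) by (intros; unfold lo, hi, const_vec; lra).
    set (m := (k * 2 ^ k)%nat).
    assert (Hm : INR m * h = INR k).
    { unfold m, h. rewrite mult_INR, pow_INR, INR_2. field. lra. }
    set (F := fun t => iter_int d lo hi (fun x => f (upd x d t))).
    assert (HF : forall s t, Rabs (F s - F t) <= L * (2 * INR k) ^ d * Rabs (s - t)).
    { intros s t. replace (2 * INR k) with (INR k - - INR k) by ring.
      rewrite <- box_vol_const. now apply iter_int_slice_lipschitz. }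
    assert (H1 := midpoint_rule F _ (- INR k) h (2 * m) (Rlt_le _ _ Hh) HF).
    replace (- INR k + INR (2 * m) * h) with (INR k) in H1
      by (rewrite mult_INR, Rmult_assoc, Hm, INR_2; ring).
    rewrite riemann_sum_S. fold m h.
    change (iter_int (S d) lo hi f) with (RInt F (- INR k) (INR k)).
    (* The intermediate quantity is the midpoint sum of the exact slice integrals [F]: the induction
       hypothesis compares it with the Riemann sum, and [H1] with the integral of [F]. *)
    assert (H3 : Rabs (sum_lt (2 * m) (fun j => h * riemann_sum d
        (fun x => f (upd x d (mid k (Z.of_nat j - Z.of_nat m)))) k) -
      sum_lt (2 * m) (fun j => h * F (- INR k + (INR j + / 2) * h)))
      <= 2 * INR k * (INR d * (L * (2 * INR k) ^ d * h))).
    { unfold Rminus at 1. rewrite <- (Rmult_1_l (sum_lt _ (fun j => h * F _))).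
      rewrite Ropp_mult_distr_l, <- sum_lt_scal, <- sum_lt_plus.
      eapply Rle_trans; [apply sum_lt_Rabs|].
      eapply Rle_trans.
      - apply sum_lt_le with (g := fun _ => h * (INR d * (L * (2 * INR k) ^ d * h))).
        intros j _.
        (* Since [INR m * h = INR k], the midpoint of the [j]-th cell counted from the left end is
           the grid sample of index [j - m]. *)
        replace (- INR k + (INR j + / 2) * h) with (mid k (Z.of_nat j - Z.of_nat m)).
        2:{ unfold mid. rewrite minus_IZR, <- !INR_IZR_INZ, <- Hm. unfold h. field. lra. }
        cbv beta. match goal with |- Rabs (?x * ?y + ?c * (?x * ?z)) <= _ =>
          replace (x * y + c * (x * z)) with (x * (y - z)) by ring end.
        rewrite Rabs_mult, (Rabs_pos_eq h) by lra.
        apply Rmult_le_compat_l; [lra|].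
        apply IHd; auto using lipschitz_upd.
      - rewrite sum_lt_const. right.
        rewrite mult_INR. rewrite INR_2. rewrite <- Hm. ring. }
    match goal with |- Rabs (?x - ?y) <= _ => match type of H3 with Rabs (_ - ?z) <= _ =>
      replace (x - y) with ((x - z) + (z - y)) by ring end end.
    eapply Rle_trans; [apply Rabs_triang|].
    eapply Rle_trans; [apply Rplus_le_compat; [exact H3|exact H1]|].
    right. rewrite mult_INR, INR_2, S_INR, <- tech_pow_Rmult.
    replace (2 * INR m * (L * (2 * INR k) ^ d * (h * h))) with
      (2 * (INR m * h) * (L * (2 * INR k) ^ d * h)) by ring.
    rewrite Hm. ring.
Qed.

Lemma pow_succ_diff_le n x : 0 <= x -> (x + 1) ^ S n - x ^ S n <= INR (S n) * (x + 1) ^ n.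
Proof.
  intros Hx. induction n.
  - simpl. lra.
  - assert (H1 : x ^ S n <= (x + 1) ^ S n) by (apply pow_incr; lra).
    rewrite S_INR. rewrite <- (tech_pow_Rmult x (S n)).
    rewrite <- (tech_pow_Rmult (x + 1) (S n)).
    assert (H2 : x * ((x + 1) ^ S n - x ^ S n) <= x * (INR (S n) * (x + 1) ^ n))
      by (now apply Rmult_le_compat_l).
    assert (H3 : 0 <= INR (S n) * (x + 1) ^ n)
      by (apply Rmult_le_pos; [apply pos_INR|apply pow_le; lra]).
    replace ((INR (S n) + 1) * (x + 1) ^ S n) with
      (x * (INR (S n) * (x + 1) ^ n) + INR (S n) * (x + 1) ^ n + (x + 1) ^ S n)
      by (simpl pow; ring).
    lra.
Qed.

Lemma pow_le_exp2 n : exists C, 0 <= C /\ forall k, INR k ^ n <= C * 2 ^ k.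
Proof.
  induction n as [|n [C [HC IH]]].
  - exists 1. split; [lra|]. intros k. rewrite Rmult_1_l. apply pow_R1_Rle. lra.
  (* With this constant, the increment of the right side from [k] to [k + 1] is exactly the bound
     that the induction hypothesis gives for the increment of the power. *)
  - exists (2 * INR (S n) * C). assert (HS := pos_INR (S n)).
    split; [nra|]. induction k.
    + simpl (INR 0). rewrite pow_i by lia. rewrite pow_O. nra.
    + assert (H := pow_succ_diff_le n (INR k) (pos_INR k)).
      specialize (IH (S k)). rewrite (S_INR k) in *.
      assert (INR (S n) * (INR k + 1) ^ n <= INR (S n) * (C * 2 ^ S k))
        by (now apply Rmult_le_compat_l).
      rewrite <- (tech_pow_Rmult 2 k) in *.
      replace (2 * INR (S n) * C * (2 * 2 ^ k)) with
        (2 * INR (S n) * C * 2 ^ k + INR (S n) * (C * (2 * 2 ^ k))) by ring.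
      lra.
Qed.

Lemma pow_div_exp2_cv n C e : 0 < e -> exists N : nat, forall k, (N <= k)%nat ->
  C * (2 * INR k) ^ n * / 2 ^ k <= e.
Proof.
  intros He.
  (* One power more than the numerator contains, so that a factor [/ INR k] is left over to produce
     the decay. *)
  destruct (pow_le_exp2 (S n)) as [D [HD H]].
  destruct (nfloor_ex (Rabs C * 2 ^ n * D / e)) as [N HN].
  { apply Rmult_le_pos; [|left; now apply Rinv_0_lt_compat].
    apply Rmult_le_pos; [|assumption].
    apply Rmult_le_pos; [apply Rabs_pos|apply pow_le; lra]. }
  exists (S N). intros k Hk. apply le_INR in Hk. rewrite S_INR in Hk.
  assert (Hk0 : 0 < INR k) by (generalize (pos_INR N); lra).
  assert (H2 : 0 < 2 ^ k) by (apply pow_lt; lra).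
  assert (HE : Rabs C * 2 ^ n * D <= e * INR k).
  { apply Rmult_le_reg_r with (/ e); [now apply Rinv_0_lt_compat|].
    replace (e * INR k * / e) with (INR k) by (field; lra).
    unfold Rdiv in HN. lra. }
  specialize (H k). rewrite <- tech_pow_Rmult in H.
  apply Rmult_le_reg_r with (2 ^ k * INR k); [nra|].
  replace (C * (2 * INR k) ^ n * / 2 ^ k * (2 ^ k * INR k)) with
    (C * (2 ^ n * (INR k * INR k ^ n))) by (rewrite Rpow_mult_distr; field; lra).
  assert (0 < 2 ^ n) by (apply pow_lt; lra).
  assert (0 <= INR k * INR k ^ n) by (apply Rmult_le_pos; [lra|apply pow_le; lra]).
  apply Rle_trans with (Rabs C * (2 ^ n * (D * 2 ^ k))).
  - apply Rle_trans with (Rabs C * (2 ^ n * (INR k * INR k ^ n))).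
    + apply Rmult_le_compat_r; [nra|apply Rle_abs].
    + apply Rmult_le_compat_l; [apply Rabs_pos|]. nra.
  - replace (Rabs C * (2 ^ n * (D * 2 ^ k))) with (Rabs C * 2 ^ n * D * 2 ^ k) by ring.
    nra.
Qed.

Lemma coord_bounds n (lo hi : vec) : exists K : nat, forall i, (i < n)%nat ->
  - INR K <= lo i /\ hi i <= INR K.
Proof.
  destruct (INR_archimed 1 (sum_lt n (fun i => Rabs (lo i)) + sum_lt n (fun i => Rabs (hi i))))
    as [K HK]; [lra|].
  exists K. intros i Hi.
  assert (H1 := sum_lt_term_le n (fun i => Rabs (lo i)) i (fun j _ => Rabs_pos _) Hi).
  assert (H2 := sum_lt_term_le n (fun i => Rabs (hi i)) i (fun j _ => Rabs_pos _) Hi).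
  simpl in H1, H2.
  assert (H3 := Rle_abs (hi i)). assert (H4 := Rle_abs (- lo i)). rewrite Rabs_Ropp in H4.
  assert (H5 := Rabs_pos (hi i)). assert (H6 := Rabs_pos (lo i)).
  lra.
Qed.

Lemma iter_int_box_ext d : forall lo hi lo' hi' f,
  (forall i, (i < d)%nat -> lo i = lo' i /\ hi i = hi' i) ->
  iter_int d lo hi f = iter_int d lo' hi' f.
Proof.
  induction d; intros lo hi lo' hi' f H; simpl; [reflexivity|].
  destruct (H d) as [-> ->]; [lia|]. apply RInt_ext. intros. apply IHd. auto.
Qed.

Lemma has_integral_lipschitz n f L lo hi :
  0 <= L -> (forall i, lo i <= hi i) -> lipschitz n L f -> supported_in n lo hi f ->
  has_integral n f (iter_int n lo hi f).
Proof.
  intros HL Hlh Hf HS e He.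
  destruct (coord_bounds n lo hi) as [K HK].
  destruct (pow_div_exp2_cv n (INR n * L) (e / 2)) as [N HN]; [lra|].
  exists (Nat.max K N). intros k Hk. unfold R_dist.
  assert (HKk : INR K <= INR k) by (apply le_INR; lia).
  (* [coord_bounds] controls the coordinates below [n] only, whereas [iter_int_shrink_box] compares
     boxes at every index; [cut] makes the box trivial beyond [n]. *)
  set (cut := fun (v : vec) c i => if Nat.ltb i n then v i else c).
  replace (iter_int n lo hi f) with (iter_int n (const_vec (- INR k)) (const_vec (INR k)) f).
  - eapply Rle_lt_trans; [now apply (riemann_sum_iter_int n f L)|].
    specialize (HN k ltac:(lia)). lra.
  - rewrite (iter_int_box_ext n lo hi (cut lo 0) (cut hi 0)).
    + apply iter_int_shrink_box with L; auto.
      * intros i. unfold cut, const_vec. destruct (Nat.ltb_spec i n) as [Hi|Hi].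
        -- specialize (HK i Hi). specialize (Hlh i). lra.
        -- generalize (pos_INR k). lra.
      * intros i. unfold cut, const_vec. destruct (Nat.ltb_spec i n) as [Hi|Hi].
        -- specialize (HK i Hi). lra.
        -- apply pos_INR.
      * intros x i Hi. unfold cut. apply Nat.ltb_lt in Hi as Hi'. rewrite Hi'. now apply HS.
    + intros i Hi. unfold cut. apply Nat.ltb_lt in Hi. now rewrite Hi.
Qed.

Lemma riemann_sum_le n f g k : (forall x, f x <= g x) -> riemann_sum n f k <= riemann_sum n g k.
Proof.
  intros H. unfold riemann_sum. apply Rmult_le_compat_l.
  - apply pow_le. left. apply Rinv_0_lt_compat, pow_lt. lra.
  - now apply grid_sum_le.
Qed.

Lemma has_integral_le n f g I I' :
  (forall x, f x <= g x) -> has_integral n f I -> has_integral n g I' -> I <= I'.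
Proof.
  intros H Hf Hg. apply Rnot_lt_le. intros Hlt.
  destruct (Hf ((I - I') / 2)) as [N1 H1]; [lra|].
  destruct (Hg ((I - I') / 2)) as [N2 H2]; [lra|].
  specialize (H1 (Nat.max N1 N2) ltac:(lia)). specialize (H2 (Nat.max N1 N2) ltac:(lia)).
  unfold R_dist in *. apply Rabs_def2 in H1, H2.
  generalize (riemann_sum_le n f g (Nat.max N1 N2) H). lra.
Qed.

Lemma has_integral_unique n f I I' : has_integral n f I -> has_integral n f I' -> I = I'.
Proof. intros. eapply UL_sequence; eassumption. Qed.

Lemma has_integral_plus n f g I I' :
  has_integral n f I -> has_integral n g I' -> has_integral n (fun x => f x + g x) (I + I').
Proof.
  intros Hf Hg e He. destruct (CV_plus _ _ _ _ Hf Hg e He) as [N HN].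
  exists N. intros k Hk. specialize (HN k Hk).
  unfold riemann_sum in *. now rewrite grid_sum_plus, Rmult_plus_distr_l.
Qed.

Lemma has_integral_scal n c f I :
  has_integral n f I -> has_integral n (fun x => c * f x) (c * I).
Proof.
  intros Hf e He.
  assert (Hc : Un_cv (fun _ => c) c).
  { intros e' He'. exists 0%nat. intros. now rewrite R_dist_eq. }
  destruct (CV_mult _ _ c I Hc Hf e He) as [N HN].
  exists N. intros k Hk. specialize (HN k Hk).
  unfold riemann_sum in *. rewrite grid_sum_scal.
  match goal with |- R_dist ?x _ < _ => match type of HN with R_dist ?y _ < _ =>
   replace x with y by ring end end. exact HN.
Qed.

(** * Integrability by Lipschitz sandwiching *)

Definition lip_cs (n : nat) (f : vec -> R) : Prop :=
  exists L lo hi, 0 <= L /\ (forall i, lo i <= hi i) /\ lipschitz n L f /\ supported_in n lo hi f.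

(* Unlike [has_integral], which samples a fixed grid, this notion is visibly invariant
   under the affine maps [affine a b]. *)
Definition jintegral (n : nat) (f : vec -> R) (I : R) : Prop :=
  forall e, 0 < e -> exists g h J K,
    (lip_cs n g /\ has_integral n g J /\ I - e <= J) /\
    (lip_cs n h /\ has_integral n h K /\ K <= I + e) /\
    forall x, g x <= f x <= h x.

Definition clamp01 (t : R) : R := Rmax 0 (Rmin 1 t).

Lemma clamp01_bounds t : 0 <= clamp01 t <= 1.
Proof.
  unfold clamp01. split; [apply Rmax_l|]. apply Rmax_lub; [lra|apply Rmin_l].
Qed.

Lemma clamp01_dist s t : Rabs (clamp01 s - clamp01 t) <= Rabs (s - t).
Proof.
  unfold clamp01, Rmin. destruct (Rle_dec 1 s), (Rle_dec 1 t); unfold Rmax;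
  repeat match goal with |- context [Rle_dec ?a ?b] => destruct (Rle_dec a b) end;
    unfold Rabs; repeat destruct Rcase_abs; lra.
Qed.

Lemma clamp01_1 t : 1 <= t -> clamp01 t = 1.
Proof. intros. unfold clamp01. rewrite Rmin_left, Rmax_right; lra. Qed.

Lemma clamp01_0 t : t <= 0 -> clamp01 t = 0.
Proof. intros. unfold clamp01. rewrite Rmin_right, Rmax_left; lra. Qed.

Lemma clamp01_id t : 0 <= t <= 1 -> clamp01 t = t.
Proof. intros. unfold clamp01. rewrite Rmin_right, Rmax_right; lra. Qed.

Lemma clamp01_le s t : s <= t -> clamp01 s <= clamp01 t.
Proof.
  intros. unfold clamp01, Rmin. destruct (Rle_dec 1 s), (Rle_dec 1 t); unfold Rmax;
  repeat match goal with |- context [Rle_dec ?a ?b] => destruct (Rle_dec a b) end; lra.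
Qed.

Lemma clamp01_ge t : t <= 1 -> t <= clamp01 t.
Proof. intros. unfold clamp01. rewrite Rmin_right by lra. apply Rmax_r. Qed.

Lemma clamp01_le_self t : 0 <= t -> clamp01 t <= t.
Proof. intros. unfold clamp01. apply Rmax_lub; [lra|apply Rmin_r]. Qed.

Lemma lipschitz_comp n L C f (F : R -> R) : 0 <= C ->
  (forall s t, Rabs (F s - F t) <= C * Rabs (s - t)) ->
  lipschitz n L f -> lipschitz n (C * L) (fun x => F (f x)).
Proof.
  intros HC HF Hf x y. eapply Rle_trans; [apply HF|].
  rewrite Rmult_assoc. apply Rmult_le_compat_l; [assumption|apply Hf].
Qed.

Lemma lipschitz_plus n L L' f g :
  lipschitz n L f -> lipschitz n L' g -> lipschitz n (L + L') (fun x => f x + g x).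
Proof.
  intros Hf Hg x y. replace (f x + g x - (f y + g y)) with ((f x - f y) + (g x - g y)) by ring.
  eapply Rle_trans; [apply Rabs_triang|]. specialize (Hf x y). specialize (Hg x y). lra.
Qed.

Lemma lipschitz_mult01 n L L' f g :
  (forall x, 0 <= f x <= 1) -> (forall x, 0 <= g x <= 1) ->
  lipschitz n L f -> lipschitz n L' g -> lipschitz n (L + L') (fun x => f x * g x).
Proof.
  intros Bf Bg Hf Hg x y.
  replace (f x * g x - f y * g y) with ((f x - f y) * g x + f y * (g x - g y)) by ring.
  eapply Rle_trans; [apply Rabs_triang|]. rewrite !Rabs_mult.
  specialize (Hf x y). specialize (Hg x y). specialize (Bf y). specialize (Bg x).
  rewrite (Rabs_pos_eq (g x)), (Rabs_pos_eq (f y)) by lra.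
  assert (A1 := Rabs_pos (f x - f y)). assert (A2 := Rabs_pos (g x - g y)). nra.
Qed.

Lemma lip_cs_has_integral n f : lip_cs n f -> exists I, has_integral n f I.
Proof.
  intros (L & lo & hi & HL & Hb & Hf & HS).
  exists (iter_int n lo hi f). now apply has_integral_lipschitz with L.
Qed.

Lemma lip_cs_plus n f g : lip_cs n f -> lip_cs n g -> lip_cs n (fun x => f x + g x).
Proof.
  intros (L & lo & hi & HL & Hb & Hf & HS) (L' & lo' & hi' & HL' & Hb' & Hg & HS').
  exists (L + L'), (fun i => Rmin (lo i) (lo' i)), (fun i => Rmax (hi i) (hi' i)).
  split; [lra|]. split; [|split].
  - intros i. specialize (Hb i). generalize (Rmin_l (lo i) (lo' i)) (Rmax_l (hi i) (hi' i)). lra.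
  - now apply lipschitz_plus.
  - intros x i Hi Hx.
    generalize (Rmin_l (lo i) (lo' i)) (Rmax_l (hi i) (hi' i))
      (Rmin_r (lo i) (lo' i)) (Rmax_r (hi i) (hi' i)). intros.
    rewrite (HS x i), (HS' x i) by (assumption || lra). ring.
Qed.

Lemma lip_cs_scal n c f : lip_cs n f -> lip_cs n (fun x => c * f x).
Proof.
  intros (L & lo & hi & HL & Hb & Hf & HS).
  exists (Rabs c * L), lo, hi. split; [|split; [assumption|split]].
  - apply Rmult_le_pos; [apply Rabs_pos|assumption].
  - apply (lipschitz_comp n L (Rabs c) f (fun t => c * t)); [apply Rabs_pos| |assumption].
    intros s t. rewrite <- Rmult_minus_distr_l, Rabs_mult. apply Rle_refl.
  - intros x i Hi Hx. rewrite (HS x i Hi Hx). ring.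
Qed.

Lemma lip_cs_clamp n f : lip_cs n f -> lip_cs n (fun x => clamp01 (f x)).
Proof.
  intros (L & lo & hi & HL & Hb & Hf & HS).
  exists (1 * L), lo, hi. split; [lra|split; [assumption|split]].
  - apply lipschitz_comp; [lra| |assumption].
    intros s t. rewrite Rmult_1_l. apply clamp01_dist.
  - intros x i Hi Hx. rewrite (HS x i Hi Hx). apply clamp01_0. lra.
Qed.

Lemma lip_cs_mult01 n L f g :
  (forall x, 0 <= f x <= 1) -> (forall x, 0 <= g x <= 1) ->
  0 <= L -> lipschitz n L f -> lip_cs n g -> lip_cs n (fun x => f x * g x).
Proof.
  intros Bf Bg HL Hf (L' & lo & hi & HL' & Hb & Hg & HS).
  exists (L + L'), lo, hi. split; [lra|split; [assumption|split]].
  - now apply lipschitz_mult01.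
  - intros x i Hi Hx. rewrite (HS x i Hi Hx). ring.
Qed.

(** Uniqueness of limits identifies [I] with an iterated integral, where the substitution is
    available, and the result is turned back into a limit of grid sums. *)
Lemma lip_cs_affine n a b f I : 0 < a -> lip_cs n f -> has_integral n f I ->
  lip_cs n (fun x => f (affine a b x)) /\
  has_integral n (fun x => f (affine a b x)) ((/ a) ^ n * I).
Proof.
  intros Ha (L & lo & hi & HL & Hb & Hf & HS) HI.
  set (lo' := fun i => (lo i - b i) / a). set (hi' := fun i => (hi i - b i) / a).
  assert (Ha' : 0 < / a) by now apply Rinv_0_lt_compat.
  assert (Hb' : forall i, lo' i <= hi' i).
  { intros i. unfold lo', hi'. specialize (Hb i). apply Rmult_le_compat_r; lra. }
  assert (Hf' : lipschitz n (L * a) (fun x => f (affine a b x))).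
  { intros x y. eapply Rle_trans; [apply Hf|]. rewrite Rmult_assoc. right. f_equal.
    unfold l1dist. rewrite <- sum_lt_scal. apply sum_lt_ext. intros i _. unfold affine.
    replace (a * x i + b i - (a * y i + b i)) with (a * (x i - y i)) by ring.
    rewrite Rabs_mult, (Rabs_pos_eq a); [reflexivity|lra]. }
  assert (Elo : affine a b lo' = lo).
  { apply functional_extensionality. intros i. unfold affine, lo'. field. lra. }
  assert (Ehi : affine a b hi' = hi).
  { apply functional_extensionality. intros i. unfold affine, hi'. field. lra. }
  assert (HS' : supported_in n lo' hi' (fun x => f (affine a b x))).
  { intros x i Hi Hx. apply (HS _ i Hi). rewrite <- Elo, <- Ehi. unfold affine.
    destruct Hx; [left|right]; nra. }
  assert (HLa : 0 <= L * a) by nra.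
  split.
  - exists (L * a), lo', hi'. auto.
  - rewrite (has_integral_unique n f I (iter_int n lo hi f)); auto.
    + rewrite <- Elo, <- Ehi, <- (iter_int_affine n a b lo' hi' f L) by auto.
      now apply has_integral_lipschitz with (L * a).
    + now apply has_integral_lipschitz with L.
Qed.

Lemma lip_cs_opp_vec n f I : lip_cs n f -> has_integral n f I ->
  lip_cs n (fun x => f (opp_vec x)) /\ has_integral n (fun x => f (opp_vec x)) I.
Proof.
  intros (L & lo & hi & HL & Hb & Hf & HS) HI.
  assert (Hb' : forall i, opp_vec hi i <= opp_vec lo i).
  { intros i. specialize (Hb i). unfold opp_vec. lra. }
  assert (Hf' : lipschitz n L (fun x => f (opp_vec x))).
  { intros x y. eapply Rle_trans; [apply Hf|]. right. f_equal.
    apply sum_lt_ext. intros i _. unfold opp_vec.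
    rewrite Rabs_minus_sym. f_equal. ring. }
  assert (HS' : supported_in n (opp_vec hi) (opp_vec lo) (fun x => f (opp_vec x))).
  { intros x i Hi Hx. apply (HS _ i Hi). unfold opp_vec in *. lra. }
  assert (Einv : forall v, opp_vec (opp_vec v) = v).
  { intros v. apply functional_extensionality. intros i. unfold opp_vec. ring. }
  split.
  - exists L, (opp_vec hi), (opp_vec lo). auto.
  - rewrite (has_integral_unique n f I (iter_int n lo hi f)); auto.
    + rewrite <- (Einv lo), <- (Einv hi), <- (iter_int_opp n _ _ f L) by auto.
      now apply has_integral_lipschitz with L.
    + now apply has_integral_lipschitz with L.
Qed.

Lemma jintegral_has_integral n f I : jintegral n f I -> has_integral n f I.
Proof.
  intros H e He.
  destruct (H (e / 2)) as (g & h & J & K & (_ & HJ & HIJ) & (_ & HK & HIK) & Hs); [lra|].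
  destruct (HJ (e / 2)) as [N1 H1]; [lra|].
  destruct (HK (e / 2)) as [N2 H2]; [lra|].
  exists (Nat.max N1 N2). intros k Hk.
  specialize (H1 k ltac:(lia)). specialize (H2 k ltac:(lia)). unfold R_dist in *.
  apply Rabs_def2 in H1, H2.
  assert (A1 := riemann_sum_le n g f k (fun x => proj1 (Hs x))).
  assert (A2 := riemann_sum_le n f h k (fun x => proj2 (Hs x))).
  apply Rabs_def1; lra.
Qed.

Lemma jintegral_unique n f I I' : jintegral n f I -> jintegral n f I' -> I = I'.
Proof. intros. eapply has_integral_unique; apply jintegral_has_integral; eassumption. Qed.

Lemma jintegral_le n f g I I' :
  (forall x, f x <= g x) -> jintegral n f I -> jintegral n g I' -> I <= I'.
Proof.
  intros H Hf Hg. apply (has_integral_le n f g); auto using jintegral_has_integral.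
Qed.

Lemma jintegral_ext n f g I : (forall x, f x = g x) -> jintegral n f I -> jintegral n g I.
Proof. intros H. replace g with f; [auto|]. now apply functional_extensionality. Qed.

Lemma jintegral_lip_cs n f : lip_cs n f -> exists I, jintegral n f I.
Proof.
  intros H. destruct (lip_cs_has_integral n f H) as [I HI].
  exists I. intros e He. exists f, f, I, I.
  repeat split; auto; lra.
Qed.

Lemma jintegral_plus n f g I I' : jintegral n f I -> jintegral n g I' ->
  jintegral n (fun x => f x + g x) (I + I').
Proof.
  intros Hf Hg e He.
  destruct (Hf (e / 2)) as (g1 & h1 & J1 & K1 & (A1 & B1 & C1) & (D1 & E1 & F1) & S1); [lra|].
  destruct (Hg (e / 2)) as (g2 & h2 & J2 & K2 & (A2 & B2 & C2) & (D2 & E2 & F2) & S2); [lra|].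
  exists (fun x => g1 x + g2 x), (fun x => h1 x + h2 x), (J1 + J2), (K1 + K2).
  split; [|split].
  - split; [now apply lip_cs_plus|]. split; [now apply has_integral_plus|lra].
  - split; [now apply lip_cs_plus|]. split; [now apply has_integral_plus|lra].
  - intros x. specialize (S1 x). specialize (S2 x). lra.
Qed.

Lemma jintegral_scal n c f I : jintegral n f I -> jintegral n (fun x => c * f x) (c * I).
Proof.
  intros Hf e He.
  assert (Hc : 0 < Rabs c + 1) by (generalize (Rabs_pos c); lra).
  destruct (Hf (e / (Rabs c + 1))) as (g & h & J & K & (A1 & B1 & C1) & (D1 & E1 & F1) & S1).
  { now apply Rdiv_lt_0_compat. }
  set (d := e / (Rabs c + 1)) in *.
  assert (Hd : d * (Rabs c + 1) = e) by (unfold d; field; lra).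
  assert (Hd0 : 0 < d) by now apply Rdiv_lt_0_compat.
  assert (P : forall k L, lip_cs n k -> has_integral n k L ->
    lip_cs n (fun x => c * k x) /\ has_integral n (fun x => c * k x) (c * L)).
  { intros. split; [now apply lip_cs_scal|now apply has_integral_scal]. }
  destruct (P g J A1 B1) as [A2 B2]. destruct (P h K D1 E1) as [D2 E2].
  destruct (Rle_dec 0 c) as [Hc0|Hc0].
  - rewrite Rabs_pos_eq in Hd by assumption.
    exists (fun x => c * g x), (fun x => c * h x), (c * J), (c * K).
    split; [|split]; [split; [assumption|split; [assumption|nra]]..|].
    intros x. specialize (S1 x). split; apply Rmult_le_compat_l; lra.
  - rewrite Rabs_left in Hd by lra.
    exists (fun x => c * h x), (fun x => c * g x), (c * K), (c * J).
    split; [|split]; [split; [assumption|split; [assumption|nra]]..|].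
    intros x. specialize (S1 x). split; apply Rmult_le_compat_neg_l; lra.
Qed.

Lemma jintegral_minus n f g I I' : jintegral n f I -> jintegral n g I' ->
  jintegral n (fun x => f x - g x) (I - I').
Proof.
  intros Hf Hg. replace (I - I') with (I + -1 * I') by ring.
  apply jintegral_ext with (fun x => f x + -1 * g x); [intros; ring|].
  now apply jintegral_plus, jintegral_scal.
Qed.

Lemma jintegral_sum n m (f : nat -> vec -> R) (I : nat -> R) : (0 < m)%nat ->
  (forall j, (j < m)%nat -> jintegral n (f j) (I j)) ->
  jintegral n (fun x => sum_lt m (fun j => f j x)) (sum_lt m I).
Proof.
  intros Hm H. destruct m as [|m]; [lia|]. clear Hm.
  induction m.
  - rewrite sum_lt_S. unfold sum_lt at 2; simpl. rewrite Rplus_0_l.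
    apply jintegral_ext with (f 0%nat); [|apply H; lia].
    intros x. unfold sum_lt; simpl. ring.
  - rewrite sum_lt_S. eapply jintegral_ext; [intros x; symmetry; apply sum_lt_S|].
    apply jintegral_plus; [apply IHm; auto|apply H; lia].
Qed.

(** Darboux's criterion: the integral is the supremum of the integrals of Lipschitz minorants. The
    bounds [g] and [h] need only be [jintegral]-integrable; replacing each by a Lipschitz function
    costs one third of [e], and their gap the last third. *)
Lemma jintegral_sandwich n f :
  (forall e, 0 < e -> exists g h J K, jintegral n g J /\ jintegral n h K /\ K - J <= e /\
     forall x, g x <= f x <= h x) ->
  exists I, jintegral n f I.
Proof.
  intros H.
  assert (Hcs : forall e, 0 < e -> exists g h J K,
    (lip_cs n g /\ has_integral n g J) /\ (lip_cs n h /\ has_integral n h K) /\ K - J <= e /\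
     forall x, g x <= f x <= h x).
  { intros e He. destruct (H (e / 3)) as (g & h & J & K & HJ & HK & HJK & S); [lra|].
    destruct (HJ (e / 3)) as (g' & g'' & J' & J'' & (A1 & A2 & A3) & _ & S1); [lra|].
    destruct (HK (e / 3)) as (h'' & h' & K'' & K' & _ & (B1 & B2 & B3) & S2); [lra|].
    exists g', h', J', K'. repeat split; auto; [lra| |];
      specialize (S x); specialize (S1 x); specialize (S2 x); lra. }
  set (E := fun J => exists g, lip_cs n g /\ has_integral n g J /\ forall x, g x <= f x).
  destruct (Hcs 1) as (g & h & J & K & HJ & HK & _ & S); [lra|].
  assert (UB : forall h K, has_integral n h K -> (forall x, f x <= h x) -> is_upper_bound E K).
  { intros h' K' HK' S' J' (g' & _ & Hg' & Sg).
    apply (has_integral_le n g' h'); auto. intros x. eapply Rle_trans; [apply Sg|apply S']. }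
  destruct (completeness E) as [I [HI1 HI2]].
  - exists K. apply (UB h); [apply HK|]. intros x. apply S.
  - exists J, g. destruct HJ. split; [assumption|split; [assumption|]]. intros x. apply S.
  - exists I. intros e He.
    destruct (Hcs e He) as (g' & h' & J' & K' & [A1 A2] & [B1 B2] & HJK & S').
    assert (J' <= I).
    { apply HI1. exists g'. split; [assumption|split; [assumption|]]. intros x. apply S'. }
    assert (I <= K').
    { apply HI2, (UB h'); [assumption|]. intros x. apply S'. }
    exists g', h', J', K'. repeat split; auto; try lra; apply S'.
Qed.

(** Clamping is monotone and fixes the values of [f], so it keeps both bounds on their sides and can
    only bring them closer to [f]. *)
Lemma jintegral_approx01 n f I e : (forall x, 0 <= f x <= 1) -> jintegral n f I -> 0 < e ->
  exists g h J K, (lip_cs n g /\ has_integral n g J) /\ (lip_cs n h /\ has_integral n h K) /\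
    K - J <= e /\ (forall x, g x <= f x <= h x) /\
    (forall x, 0 <= g x <= 1) /\ (forall x, 0 <= h x <= 1).
Proof.
  intros Bf Hf He.
  destruct (Hf (e / 2)) as (g & h & J & K & (A1 & A2 & A3) & (B1 & B2 & B3) & S); [lra|].
  destruct (lip_cs_has_integral n _ (lip_cs_clamp n g A1)) as [J' HJ'].
  destruct (lip_cs_has_integral n _ (lip_cs_clamp n h B1)) as [K' HK'].
  assert (J <= J').
  { eapply has_integral_le; [|eassumption..]. intros x. cbv beta.
    specialize (Bf x). specialize (S x). apply clamp01_ge. lra. }
  assert (K' <= K).
  { eapply has_integral_le; [|eassumption..]. intros x. cbv beta.
    specialize (Bf x). specialize (S x). apply clamp01_le_self. lra. }
  exists (fun x => clamp01 (g x)), (fun x => clamp01 (h x)), J', K'.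
  split; [split; [now apply lip_cs_clamp|assumption]|].
  split; [split; [now apply lip_cs_clamp|assumption]|].
  split; [lra|]. split; [|split; intros; apply clamp01_bounds].
  intros x. specialize (S x). rewrite <- (clamp01_id (f x) (Bf x)).
  split; apply clamp01_le; apply S.
Qed.

(** For factors in [0, 1] with g1 <= h1 and g2 <= h2, the gap h1 h2 - g1 g2 is at most (h1 - g1) +
    (h2 - g2), so the products of the approximants again form a tight sandwich. *)
Lemma jintegral_mult01 n f g I I' :
  (forall x, 0 <= f x <= 1) -> (forall x, 0 <= g x <= 1) ->
  jintegral n f I -> jintegral n g I' -> exists K, jintegral n (fun x => f x * g x) K.
Proof.
  intros Bf Bg Hf Hg. apply jintegral_sandwich. intros e He.
  destruct (jintegral_approx01 n f I (e / 2) Bf Hf)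
    as (g1 & h1 & J1 & K1 & [A1 A1'] & [D1 D1'] & E1 & S1 & Bg1 & Bh1); [lra|].
  destruct (jintegral_approx01 n g I' (e / 2) Bg Hg)
    as (g2 & h2 & J2 & K2 & [A2 A2'] & [D2 D2'] & E2 & S2 & Bg2 & Bh2); [lra|].
  assert (P : forall u v, lip_cs n u -> lip_cs n v -> (forall x, 0 <= u x <= 1) ->
    (forall x, 0 <= v x <= 1) -> exists J, jintegral n (fun x => u x * v x) J).
  { intros u v (L & lo & hi & HL & _ & Hu & _) Hv Bu Bv.
    apply jintegral_lip_cs. now apply lip_cs_mult01 with L. }
  destruct (P g1 g2) as [J HJ]; auto. destruct (P h1 h2) as [K HK]; auto.
  exists (fun x => g1 x * g2 x), (fun x => h1 x * h2 x), J, K.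
  split; [assumption|]. split; [assumption|]. split.
  - assert (Q : K - J <= (K1 + -1 * J1) + (K2 + -1 * J2)); [|lra].
    replace (K - J) with (K + -1 * J) by ring.
    eapply has_integral_le.
    2:{ apply has_integral_plus; [|apply has_integral_scal];
        apply jintegral_has_integral; eassumption. }
    2:{ apply has_integral_plus; (apply has_integral_plus; [|apply has_integral_scal]);
        eassumption. }
    intros x. cbv beta. specialize (S1 x). specialize (S2 x). specialize (Bg1 x).
    specialize (Bg2 x). specialize (Bh1 x). specialize (Bh2 x). nra.
  - intros x. specialize (S1 x). specialize (S2 x). specialize (Bg1 x).
    specialize (Bg2 x). specialize (Bh1 x). specialize (Bh2 x).
    split; apply Rmult_le_compat; lra.
Qed.

Lemma jintegral_affine n a b f I : 0 < a -> jintegral n f I ->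
  jintegral n (fun x => f (affine a b x)) ((/ a) ^ n * I).
Proof.
  intros Ha Hf e He.
  assert (Hp : 0 < (/ a) ^ n) by (now apply pow_lt, Rinv_0_lt_compat).
  destruct (Hf (e / (/ a) ^ n)) as (g & h & J & K & (A1 & B1 & C1) & (D1 & E1 & F1) & S1).
  { now apply Rdiv_lt_0_compat. }
  exists (fun x => g (affine a b x)), (fun x => h (affine a b x)),
    ((/ a) ^ n * J), ((/ a) ^ n * K).
  apply (Rmult_le_compat_l ((/ a) ^ n)) in C1; [|lra].
  apply (Rmult_le_compat_l ((/ a) ^ n)) in F1; [|lra].
  assert (E0 : (/ a) ^ n * (e / (/ a) ^ n) = e)
    by (generalize dependent ((/ a) ^ n); intros; field; lra).
  destruct (lip_cs_affine n a b g J Ha A1 B1). destruct (lip_cs_affine n a b h K Ha D1 E1).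
  split; [|split]; [repeat split; auto; lra..|]. intros x. apply S1.
Qed.

Lemma jintegral_opp_vec n f I : jintegral n f I -> jintegral n (fun x => f (opp_vec x)) I.
Proof.
  intros Hf e He.
  destruct (Hf e He) as (g & h & J & K & (A1 & B1 & C1) & (D1 & E1 & F1) & S1).
  exists (fun x => g (opp_vec x)), (fun x => h (opp_vec x)), J, K.
  destruct (lip_cs_opp_vec n g J A1 B1). destruct (lip_cs_opp_vec n h K D1 E1).
  split; [|split]; [repeat split; auto; lra..|]. intros x. apply S1.
Qed.

(** * Euclidean norm and balls *)

Lemma dot_self_nonneg n x : 0 <= dot n x x.
Proof. apply sum_lt_nonneg. intros. apply Rle_0_sqr. Qed.

Lemma dot_sym n x y : dot n x y = dot n y x.
Proof. apply sum_lt_ext. intros. ring. Qed.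

Lemma dot_affine_l n a x y z :
  dot n (fun i => a * x i + y i) z = a * dot n x z + dot n y z.
Proof.
  unfold dot. rewrite <- sum_lt_scal, <- sum_lt_plus. apply sum_lt_ext. intros. ring.
Qed.

Lemma dot_affine_r n a x y z :
  dot n z (fun i => a * x i + y i) = a * dot n z x + dot n z y.
Proof. rewrite dot_sym, dot_affine_l, !(dot_sym n z). reflexivity. Qed.

Lemma norm_nonneg n x : 0 <= norm n x.
Proof. apply sqrt_pos. Qed.

Lemma norm_sqr n x : norm n x * norm n x = dot n x x.
Proof. apply sqrt_sqrt, dot_self_nonneg. Qed.

(** The quadratic t -> |t x + y|^2 is nonnegative; it is evaluated at its minimizer. *)
Lemma dot_sqr_le n x y : dot n x y * dot n x y <= dot n x x * dot n y y.
Proof.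
  assert (H : forall t, 0 <= t * t * dot n x x + 2 * t * dot n x y + dot n y y).
  { intros t. generalize (dot_self_nonneg n (fun i => t * x i + y i)).
    rewrite dot_affine_l, !dot_affine_r, (dot_sym n y x). lra. }
  assert (HX := dot_self_nonneg n x). assert (HY := dot_self_nonneg n y).
  set (X := dot n x x) in *. set (Y := dot n y y) in *. set (B := dot n x y) in *.
  destruct (Req_dec X 0) as [E|E].
  - destruct (Req_dec B 0) as [->|EB]; [nra|].
    (* When [X = 0] the quadratic is affine in t with slope [2 * B]; at this t it equals -1. *)
    specialize (H (- (Y + 1) / (2 * B))). rewrite E in H.
    replace (2 * (- (Y + 1) / (2 * B)) * B) with (- (Y + 1)) in H by (field; lra). lra.
  - specialize (H (- B / X)).
    replace (- B / X * (- B / X) * X + 2 * (- B / X) * B + Y) with ((X * Y - B * B) / X) in H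
      by (field; lra).
    apply (Rmult_le_compat_r X) in H; [|assumption].
    replace ((X * Y - B * B) / X * X) with (X * Y - B * B) in H by (field; lra). lra.
Qed.

Lemma cauchy_schwarz n x y : Rabs (dot n x y) <= norm n x * norm n y.
Proof.
  assert (Hx := norm_nonneg n x). assert (Hy := norm_nonneg n y).
  apply Rsqr_incr_0_var; [|nra].
  rewrite <- Rsqr_abs. unfold Rsqr.
  replace (norm n x * norm n y * (norm n x * norm n y))
    with ((norm n x * norm n x) * (norm n y * norm n y)) by ring.
  rewrite !norm_sqr. apply dot_sqr_le.
Qed.

Lemma norm_plus_le n x y : norm n (fun i => x i + y i) <= norm n x + norm n y.
Proof.
  assert (Hx := norm_nonneg n x). assert (Hy := norm_nonneg n y).
  apply Rsqr_incr_0_var; [|lra]. unfold Rsqr. rewrite norm_sqr.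
  assert (E : dot n (fun i => x i + y i) (fun i => x i + y i) =
    dot n x x + 2 * dot n x y + dot n y y).
  { replace (fun i => x i + y i) with (fun i => 1 * x i + y i)
      by (apply functional_extensionality; intros; ring).
    rewrite dot_affine_l, !dot_affine_r, (dot_sym n y x). ring. }
  rewrite E, <- !norm_sqr. generalize (cauchy_schwarz n x y) (Rle_abs (dot n x y)). nra.
Qed.

Lemma norm_scal n c x : norm n (fun i => c * x i) = Rabs c * norm n x.
Proof.
  unfold norm. rewrite <- (sqrt_Rsqr_abs c), <- sqrt_mult_alt by apply Rle_0_sqr.
  f_equal. unfold dot, Rsqr. rewrite <- sum_lt_scal. apply sum_lt_ext. intros. ring.
Qed.

Lemma norm_opp_vec n x : norm n (opp_vec x) = norm n x.
Proof. unfold norm. f_equal. apply sum_lt_ext. intros. unfold opp_vec. ring. Qed.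

Lemma norm_ext n x y : (forall i, (i < n)%nat -> x i = y i) -> norm n x = norm n y.
Proof. intros H. unfold norm. f_equal. apply sum_lt_ext. intros. now rewrite H. Qed.

Lemma norm_0_coord n x i : norm n x = 0 -> (i < n)%nat -> x i = 0.
Proof.
  intros H Hi. assert (E := norm_sqr n x). rewrite H, Rmult_0_l in E.
  assert (H1 := sum_lt_term_le n (fun i => x i * x i) i (fun j _ => Rle_0_sqr _) Hi).
  cbv beta in H1. unfold dot in E. nra.
Qed.

Lemma coord_le_norm n x i : (i < n)%nat -> Rabs (x i) <= norm n x.
Proof.
  intros Hi. apply Rsqr_incr_0_var; [|apply norm_nonneg].
  rewrite <- Rsqr_abs. unfold Rsqr. rewrite norm_sqr.
  apply (sum_lt_term_le n (fun i => x i * x i) i (fun j _ => Rle_0_sqr _) Hi).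
Qed.

Lemma norm_le_l1 n x : norm n x <= sum_lt n (fun i => Rabs (x i)).
Proof.
  assert (P : forall m, 0 <= sum_lt m (fun i => Rabs (x i))).
  { intros m. apply sum_lt_nonneg. intros. apply Rabs_pos. }
  apply Rsqr_incr_0_var; [|apply P]. unfold Rsqr. rewrite norm_sqr. unfold dot.
  induction n; [unfold sum_lt; simpl; lra|]. rewrite !sum_lt_S.
  assert (E : x n * x n = Rabs (x n) * Rabs (x n))
    by (now rewrite <- Rabs_mult, Rabs_pos_eq by apply Rle_0_sqr).
  rewrite E. specialize (P n). generalize (Rabs_pos (x n)). nra.
Qed.

Lemma norm_lipschitz n : lipschitz n 1 (norm n).
Proof.
  assert (H : forall x y, norm n x - norm n y <= l1dist n x y).
  { intros x y. eapply Rle_trans; [|apply norm_le_l1].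
    assert (T := norm_plus_le n (fun i => x i - y i) y). cbv beta in T.
    rewrite (norm_ext n (fun i => x i - y i + y i) x) in T by (intros; ring). lra. }
  intros x y. rewrite Rmult_1_l. apply Rabs_le. split; [|apply H].
  assert (E : l1dist n y x = l1dist n x y).
  { apply sum_lt_ext. intros. apply Rabs_minus_sym. }
  specialize (H y x). lra.
Qed.

Lemma dot_lipschitz n v : lipschitz n (norm n v) (fun x => dot n v x).
Proof.
  intros x y.
  replace (dot n v x - dot n v y) with (dot n v (fun i => x i - y i)).
  - eapply Rle_trans; [apply cauchy_schwarz|].
    apply Rmult_le_compat_l; [apply norm_nonneg|apply norm_le_l1].
  - replace (fun i => x i - y i) with (fun i => -1 * y i + x i)
      by (apply functional_extensionality; intros; ring).
    rewrite dot_affine_r. ring.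
Qed.

Lemma lip_cs_radial n (F : R -> R) C s : 0 <= C -> 0 <= s ->
  (forall u v, Rabs (F u - F v) <= C * Rabs (u - v)) ->
  (forall t, s <= t -> F t = 0) -> lip_cs n (fun x => F (norm n x)).
Proof.
  intros HC Hs HF HZ. exists (C * 1), (const_vec (- s)), (const_vec s).
  split; [lra|]. split; [intros; unfold const_vec; lra|]. split.
  - apply lipschitz_comp; auto using norm_lipschitz.
  - intros x i Hi Hx. apply HZ. eapply Rle_trans; [|now apply (coord_le_norm n x i)].
    unfold const_vec in Hx. unfold Rabs. destruct Rcase_abs; lra.
Qed.

(* Piecewise linear cutoff: 1 on [0, 1], 0 beyond [/ q]. *)
Definition tent (q t : R) : R := clamp01 ((1 - q * t) / (1 - q)).

Lemma tent_1 q t : 0 < q < 1 -> t <= 1 -> tent q t = 1.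
Proof.
  intros Hq Ht. apply clamp01_1.
  apply Rmult_le_reg_r with (1 - q); [lra|].
  replace ((1 - q * t) / (1 - q) * (1 - q)) with (1 - q * t) by (field; lra). nra.
Qed.

Lemma tent_0 q t : 0 < q < 1 -> 1 <= q * t -> tent q t = 0.
Proof.
  intros Hq Ht. apply clamp01_0.
  apply Rmult_le_reg_r with (1 - q); [lra|].
  replace ((1 - q * t) / (1 - q) * (1 - q)) with (1 - q * t) by (field; lra). lra.
Qed.

(** Bounds the integral of [tent q] by a constant independent of [q], so that [q] can afterwards be
    chosen in terms of that constant. *)
Lemma tent_le_half q t : / 2 <= q < 1 -> 0 <= t -> tent q t <= tent (/ 2) t.
Proof.
  intros Hq Ht. destruct (Rle_dec t 1).
  - rewrite !tent_1 by lra. lra.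
  - apply clamp01_le. apply Rmult_le_reg_r with (1 - q); [lra|].
    replace ((1 - q * t) / (1 - q) * (1 - q)) with (1 - q * t) by (field; lra).
    replace ((1 - / 2 * t) / (1 - / 2) * (1 - q)) with ((2 - t) * (1 - q)) by field. nra.
Qed.

Lemma lip_cs_tent n q : 0 < q < 1 -> lip_cs n (fun x => tent q (norm n x)).
Proof.
  intros Hq.
  assert (0 < / q) by (apply Rinv_0_lt_compat; lra).
  apply lip_cs_radial with (q / (1 - q)) (/ q); try lra.
  - left. apply Rdiv_lt_0_compat; lra.
  - intros u v. unfold tent. eapply Rle_trans; [apply clamp01_dist|].
    replace ((1 - q * u) / (1 - q) - (1 - q * v) / (1 - q)) with (- (q / (1 - q)) * (u - v))
      by (field; lra).
    rewrite Rabs_mult, Rabs_Ropp, Rabs_pos_eq; [apply Rle_refl|].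
    left. apply Rdiv_lt_0_compat; lra.
  - intros t Ht. apply tent_0; [assumption|].
    apply (Rmult_le_compat_l q) in Ht; [|lra]. rewrite Rinv_r in Ht; lra.
Qed.

Lemma norm_affine0 n a x : 0 < a -> norm n (affine a zero_vec x) = a * norm n x.
Proof.
  intros Ha. rewrite <- (Rabs_pos_eq a) at 2 by lra. rewrite <- norm_scal.
  apply norm_ext. intros. unfold affine, zero_vec. ring.
Qed.

Lemma bernoulli q n : 0 <= q <= 1 -> 1 - q ^ n <= INR n * (1 - q).
Proof.
  intros Hq. induction n; [simpl; lra|]. rewrite S_INR, <- tech_pow_Rmult.
  assert (0 <= q ^ n) by (apply pow_le; lra).
  assert (q ^ n <= 1) by (rewrite <- (pow1 n); apply pow_incr; lra). nra.
Qed.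

Lemma indic_bounds S x : 0 <= indic S x <= 1.
Proof. unfold indic. destruct excluded_middle_informative; lra. Qed.

Lemma indic_in (S : vec -> Prop) x : S x -> indic S x = 1.
Proof. unfold indic. destruct excluded_middle_informative; tauto. Qed.

Lemma indic_out (S : vec -> Prop) x : ~ S x -> indic S x = 0.
Proof. unfold indic. destruct excluded_middle_informative; tauto. Qed.

Lemma indic_iff (S T : vec -> Prop) x y : (S x <-> T y) -> indic S x = indic T y.
Proof. intros H. unfold indic. repeat destruct excluded_middle_informative; tauto. Qed.

Lemma ball_zero n r x : ball n zero_vec r x <-> norm n x <= r.
Proof.
  unfold ball. rewrite (norm_ext n (fun i => x i - zero_vec i) x); [tauto|].
  intros. unfold zero_vec. ring.
Qed.

(* The cutoff [tent q] lies above the indicator of the unit ball and its copy shrunk by the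
   factor [q] lies below, so by homogeneity the two integrals differ by the factor [q ^ n]. *)
Lemma jintegral_unit_ball n : exists I, jintegral n (indic (ball n zero_vec 1)) I.
Proof.
  apply jintegral_sandwich. intros e He.
  destruct (jintegral_lip_cs n _ (lip_cs_tent n (/ 2) ltac:(lra))) as [I1 HI1].
  assert (HI1p : 0 <= I1).
  { replace 0 with (0 * I1) by ring.
    apply (jintegral_le n (fun x => 0 * tent (/ 2) (norm n x)) (fun x => tent (/ 2) (norm n x)));
      [|now apply jintegral_scal|assumption].
    intros x. unfold tent. generalize (clamp01_bounds ((1 - / 2 * norm n x) / (1 - / 2))). lra. }
  assert (HnI : 0 <= INR n * I1) by (apply Rmult_le_pos; [apply pos_INR|assumption]).
  (* The gap between the two bounds is (1 - q^n) I, at most n (1 - q) [I1] by [bernoulli]. The cap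
     [/ 2] keeps [q >= / 2] for [tent_le_half], and the [+ 1] keeps the denominator positive. *)
  set (q := 1 - Rmin (/ 2) (e / (INR n * I1 + 1))).
  assert (Hq : / 2 <= q < 1 /\ (INR n * I1) * (1 - q) <= e).
  { assert (Hp : 0 < e / (INR n * I1 + 1)) by (apply Rdiv_lt_0_compat; lra).
    assert (M1 := Rmin_l (/ 2) (e / (INR n * I1 + 1))).
    assert (M2 := Rmin_r (/ 2) (e / (INR n * I1 + 1))).
    assert (M3 : 0 < Rmin (/ 2) (e / (INR n * I1 + 1))) by (apply Rmin_glb_lt; lra).
    unfold q. set (m := Rmin _ _) in *. split; [lra|].
    apply (Rmult_le_compat_l (INR n * I1 + 1)) in M2; [|lra].
    replace ((INR n * I1 + 1) * (e / (INR n * I1 + 1))) with e in M2 by (field; lra). nra. }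
  destruct Hq as [Hq Hqe].
  destruct (jintegral_lip_cs n _ (lip_cs_tent n q ltac:(lra))) as [I HI].
  assert (HII : I <= I1).
  { eapply jintegral_le; [|eassumption..]. intros x. apply tent_le_half; [lra|apply norm_nonneg]. }
  assert (HIp : 0 <= I).
  { replace 0 with (0 * I) by ring.
    apply (jintegral_le n (fun x => 0 * tent q (norm n x)) (fun x => tent q (norm n x)));
      [|now apply jintegral_scal|assumption].
    intros x. unfold tent. generalize (clamp01_bounds ((1 - q * norm n x) / (1 - q))). lra. }
  assert (Hiq : 0 < / q) by (apply Rinv_0_lt_compat; lra).
  assert (HJ := jintegral_affine n (/ q) zero_vec _ _ Hiq HI).
  rewrite Rinv_inv in HJ. cbv beta in HJ.
  exists (fun x => tent q (norm n (affine (/ q) zero_vec x))), (fun x => tent q (norm n x)),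
    (q ^ n * I), I.
  split; [assumption|]. split; [assumption|]. split.
  - assert (B := bernoulli q n ltac:(lra)).
    assert (B2 : 0 <= INR n * (1 - q)) by (apply Rmult_le_pos; [apply pos_INR|lra]).
    nra.
  - intros x. rewrite norm_affine0 by assumption.
    assert (B1 := clamp01_bounds ((1 - q * norm n x) / (1 - q))).
    assert (B2 := clamp01_bounds ((1 - q * (/ q * norm n x)) / (1 - q))).
    fold (tent q (norm n x)) in B1. fold (tent q (/ q * norm n x)) in B2.
    destruct (Rle_dec (norm n x) 1) as [Hx|Hx].
    + rewrite indic_in by (now apply ball_zero). rewrite (tent_1 q (norm n x)) by lra. lra.
    + rewrite indic_out by (rewrite ball_zero; lra).
      rewrite (tent_0 q (/ q * norm n x)); [lra..|].
      rewrite <- Rmult_assoc, Rinv_r by lra. lra.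
Qed.

Lemma ball_affine n c s x : 0 < s ->
  ball n c s x <-> ball n zero_vec 1 (affine (/ s) (fun i => - / s * c i) x).
Proof.
  intros Hs. rewrite ball_zero. unfold ball.
  rewrite (norm_ext n (affine (/ s) (fun i => - / s * c i) x) (fun i => / s * (x i - c i)))
    by (intros; unfold affine; ring).
  assert (Hs' : 0 < / s) by now apply Rinv_0_lt_compat.
  rewrite norm_scal, Rabs_pos_eq by lra.
  assert (E : / s * s = 1) by (field; lra).
  split; intros H.
  - apply (Rmult_le_compat_l (/ s)) in H; lra.
  - apply Rmult_le_reg_l with (/ s); lra.
Qed.

Lemma jintegral_ball n c s : 0 < s -> exists I, jintegral n (indic (ball n c s)) I.
Proof.
  intros Hs. destruct (jintegral_unit_ball n) as [I HI].
  exists ((/ / s) ^ n * I).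
  eapply jintegral_ext; [|apply jintegral_affine; [now apply Rinv_0_lt_compat|exact HI]].
  intros x. symmetry. apply indic_iff. now apply ball_affine.
Qed.

(** The indicator of an intersection is a product of indicators. The induction starts from one ball,
    as the empty intersection would be the whole space. *)
Lemma jintegral_inter_balls n N p r : (1 <= N)%nat -> 0 < r ->
  exists I, jintegral n (indic (inter_balls n N p r)) I.
Proof.
  intros HN Hr. destruct N as [|m]; [lia|]. clear HN. induction m as [|m [I HI]].
  - destruct (jintegral_ball n (p 0%nat) r Hr) as [I HI]. exists I.
    eapply jintegral_ext; [|exact HI]. intros x. apply indic_iff. split.
    + intros H i Hi. now replace i with 0%nat by lia.
    + intros H. apply H. lia.
  - destruct (jintegral_ball n (p (S m)) r Hr) as [I' HI'].
    destruct (jintegral_mult01 n _ _ I I' (indic_bounds _) (indic_bounds _) HI HI') as [K HK].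
    exists K. eapply jintegral_ext; [|exact HK]. intros x. cbv beta.
    destruct (classic (inter_balls n (S (S m)) p r x)) as [H|H].
    + rewrite !indic_in; [ring|exact H|apply H; lia|intros i Hi; apply H; lia].
    + rewrite (indic_out _ _ H).
      destruct (classic (ball n (p (S m)) r x)) as [Hb|Hb]; [|rewrite (indic_out _ _ Hb); ring].
      rewrite (indic_out (inter_balls n (S m) p r)); [ring|]. intros Hi. apply H.
      intros i Hlt. destruct (Nat.eq_dec i (S m)) as [->|Hne]; [assumption|]. apply Hi. lia.
Qed.

(** * Functions of the direction *)

(** [H x / norm n x] oscillates at the origin; keeping the denominator above [eta] removes this. The
    variation of the numerator and that of the denominator each contribute P / eta. *)
Lemma homogeneous_cutoff_lipschitz n P H eta : 0 < eta -> 0 <= P ->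
  lipschitz n P H -> (forall x, Rabs (H x) <= P * norm n x) ->
  lipschitz n (2 * P / eta) (fun x => H x / Rmax eta (norm n x)).
Proof.
  intros He HP HL HB x y.
  assert (Hl := norm_lipschitz n x y). rewrite Rmult_1_l in Hl.
  specialize (HL x y). specialize (HB y).
  set (l := l1dist n x y) in *.
  assert (Hl0 : 0 <= l) by apply l1dist_nonneg.
  assert (A1 := Rmax_l eta (norm n x)). assert (B1 := Rmax_l eta (norm n y)).
  assert (B2 := Rmax_r eta (norm n y)).
  assert (AB : Rabs (Rmax eta (norm n y) - Rmax eta (norm n x)) <= l).
  { eapply Rle_trans; [|exact Hl]. unfold Rmax.
    repeat destruct Rle_dec; unfold Rabs; repeat destruct Rcase_abs; lra. }
  set (a := Rmax eta (norm n x)) in *. set (b := Rmax eta (norm n y)) in *.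
  assert (Ea : 0 < / a <= / eta).
  { split; [apply Rinv_0_lt_compat; lra|apply Rinv_le_contravar; lra]. }
  assert (Eb : 0 < / b) by (apply Rinv_0_lt_compat; lra).
  replace (H x / a - H y / b) with ((H x - H y) * / a + (H y * / b) * ((b - a) * / a))
    by (field; lra).
  eapply Rle_trans; [apply Rabs_triang|]. rewrite !Rabs_mult.
  rewrite (Rabs_pos_eq (/ a)), (Rabs_pos_eq (/ b)) by lra.
  assert (F1 : Rabs (H x - H y) * / a <= P * l * / eta).
  { apply Rmult_le_compat; try lra. apply Rabs_pos. }
  assert (F2 : Rabs (H y) * / b <= P).
  { apply Rmult_le_reg_r with b; [lra|]. rewrite Rmult_assoc, Rinv_l by lra.
    assert (P * norm n y <= P * b) by (apply Rmult_le_compat_l; lra). lra. }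
  assert (F3 : Rabs (b - a) * / a <= l * / eta).
  { apply Rmult_le_compat; try lra. apply Rabs_pos. }
  assert (F4 : Rabs (H y) * / b * (Rabs (b - a) * / a) <= P * (l * / eta)).
  { apply Rmult_le_compat; auto.
    - apply Rmult_le_pos; [apply Rabs_pos|lra].
    - apply Rmult_le_pos; [apply Rabs_pos|lra]. }
  unfold Rdiv. lra.
Qed.

Lemma small_pow n e C : (1 <= n)%nat -> 0 < e -> 0 <= C -> exists t, 0 < t /\ t ^ n * C <= e.
Proof.
  intros Hn He HC. set (t := Rmin 1 (e / (C + 1))).
  assert (Hp : 0 < e / (C + 1)) by (apply Rdiv_lt_0_compat; lra).
  assert (M1 := Rmin_l 1 (e / (C + 1))). assert (M2 := Rmin_r 1 (e / (C + 1))).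
  assert (M3 : 0 < t) by (apply Rmin_glb_lt; lra). fold t in M1, M2.
  exists t. split; [assumption|].
  apply (Rmult_le_compat_l (C + 1)) in M2; [|lra].
  replace ((C + 1) * (e / (C + 1))) with e in M2 by (field; lra).
  assert (t ^ n <= t).
  { destruct n; [lia|]. rewrite <- tech_pow_Rmult.
    assert (t ^ n <= 1) by (rewrite <- (pow1 n); apply pow_incr; lra). nra. }
  nra.
Qed.

(** The cutoff [Rmax eta] alters the function only where |x| < eta. There the error is at most
    tent(|x| / eta), whose integral is eta^n times a constant. A Lipschitz tent stands in for the
    ball until the sandwich is complete. *)
Lemma jintegral_angular_unit n P H Psi C : (1 <= n)%nat -> 0 <= P -> 0 <= C ->
  lipschitz n P H -> (forall x, Rabs (H x) <= P * norm n x) ->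
  (forall t, 0 <= Psi t <= 1) -> (forall s t, Rabs (Psi s - Psi t) <= C * Rabs (s - t)) ->
  exists I, jintegral n (fun x => Psi (H x / norm n x) * indic (ball n zero_vec 1) x) I.
Proof.
  intros Hn HP HC HL HB BP LP.
  assert (BT : forall t, 0 <= tent (/ 2) t <= 1) by (intros; apply clamp01_bounds).
  assert (LT := lip_cs_tent n (/ 2) ltac:(lra)).
  assert (HG : exists J, jintegral n (fun x => Psi (H x / norm n x) * tent (/ 2) (norm n x)) J).
  { apply jintegral_sandwich. intros e He.
    destruct (jintegral_lip_cs n _ LT) as [T HT].
    assert (HT0 : 0 <= T).
    { replace 0 with (0 * T) by ring.
      eapply jintegral_le; [|apply jintegral_scal; exact HT|exact HT].
      intros x. cbv beta. generalize (BT (norm n x)). lra. }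
    destruct (small_pow n e (2 * T)) as [eta [He0 Heta]]; [assumption|assumption|lra|].
    assert (Hie : 0 < / eta) by now apply Rinv_0_lt_compat.
    set (w := fun x => H x / Rmax eta (norm n x)).
    assert (Hw : lip_cs n (fun x => Psi (w x) * tent (/ 2) (norm n x))).
    { apply lip_cs_mult01 with (C * (2 * P / eta)); auto.
      - apply Rmult_le_pos; [assumption|]. apply Rmult_le_pos; lra.
      - apply lipschitz_comp; auto. now apply homogeneous_cutoff_lipschitz. }
    destruct (jintegral_lip_cs n _ Hw) as [W HW].
    assert (HE := jintegral_affine n (/ eta) zero_vec _ _ Hie HT). cbv beta in HE.
    rewrite Rinv_inv in HE.
    eexists _, _, _, _. split; [exact (jintegral_minus n _ _ _ _ HW HE)|].
    split; [exact (jintegral_plus n _ _ _ _ HW HE)|]. split; [lra|].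
    intros x. cbv beta. rewrite norm_affine0 by assumption.
    assert (B1 := BT (/ eta * norm n x)). assert (B2 := BT (norm n x)).
    assert (B3 := BP (w x)). assert (B4 := BP (H x / norm n x)).
    destruct (Rle_dec eta (norm n x)) as [Hx|Hx].
    - unfold w. rewrite Rmax_right by assumption. lra.
    - rewrite (tent_1 (/ 2) (/ eta * norm n x)); [nra|lra|].
      apply Rmult_le_reg_l with eta; [assumption|].
      rewrite <- Rmult_assoc, Rinv_r by lra. lra. }
  destruct HG as [J HJ]. destruct (jintegral_unit_ball n) as [D HD].
  assert (BJ : forall x, 0 <= Psi (H x / norm n x) * tent (/ 2) (norm n x) <= 1).
  { intros x. specialize (BP (H x / norm n x)). specialize (BT (norm n x)). nra. }
  (* The tent equals 1 on the unit ball, so multiplying by the indicator of the ball leaves exactly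
     the desired cutoff. *)
  destruct (jintegral_mult01 n _ _ J D BJ (indic_bounds _) HJ HD) as [K HK].
  exists K. eapply jintegral_ext; [|exact HK]. intros x. cbv beta.
  destruct (Rle_dec (norm n x) 1) as [Hx|Hx].
  - rewrite tent_1 by lra. ring.
  - rewrite indic_out by (rewrite ball_zero; lra). ring.
Qed.

Lemma jintegral_angular n P H Psi C : (1 <= n)%nat -> 0 <= P -> 0 <= C ->
  lipschitz n P H -> (forall x, Rabs (H x) <= P * norm n x) ->
  (forall a x, 0 < a -> H (affine a zero_vec x) = a * H x) ->
  (forall t, 0 <= Psi t <= 1) -> (forall s t, Rabs (Psi s - Psi t) <= C * Rabs (s - t)) ->
  exists I, forall s, 0 < s ->
    jintegral n (fun x => Psi (H x / norm n x) * indic (ball n zero_vec s) x) (s ^ n * I).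
Proof.
  intros Hn HP HC HL HB HH BP LP.
  destruct (jintegral_angular_unit n P H Psi C Hn HP HC HL HB BP LP) as [I HI].
  exists I. intros s Hs.
  assert (Hs' : 0 < / s) by now apply Rinv_0_lt_compat.
  assert (HE := jintegral_affine n (/ s) zero_vec _ _ Hs' HI). cbv beta in HE.
  rewrite Rinv_inv in HE. eapply jintegral_ext; [|exact HE].
  intros x. cbv beta. f_equal.
  - f_equal. rewrite HH, norm_affine0 by assumption.
    (* At norm 0 both quotients divide by zero, but [H] vanishes there, so both are 0. *)
    destruct (Req_dec (norm n x) 0) as [E|E].
    + assert (H x = 0) as ->; [|unfold Rdiv; ring].
      specialize (HB x). rewrite E, Rmult_0_r in HB.
      unfold Rabs in HB; destruct Rcase_abs; lra.
    + field. lra.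
  - apply indic_iff. rewrite !ball_zero, norm_affine0 by assumption.
    assert (E : / s * s = 1) by (field; lra).
    split; intros Hx.
    + apply Rmult_le_reg_l with (/ s); lra.
    + apply (Rmult_le_compat_l (/ s)) in Hx; lra.
Qed.

(** * The support function of the hull *)

(** [m] is the last index, not the number of points: with [m + 1] points the maximum is never over
    an empty family. *)
Fixpoint hull_support (n m : nat) (p : nat -> vec) (x : vec) : R :=
  match m with
  | O => dot n (p O) x
  | S m' => Rmax (hull_support n m' p x) (dot n (p m) x)
  end.

Lemma hull_support_ge n m p x i : (i <= m)%nat -> dot n (p i) x <= hull_support n m p x.
Proof.
  induction m; intros Hi; simpl.
  - replace i with 0%nat by lia. lra.
  - destruct (Nat.eq_dec i (S m)) as [->|Hne]; [apply Rmax_r|].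
    eapply Rle_trans; [apply IHm; lia|apply Rmax_l].
Qed.

Lemma hull_support_attained n m p x :
  exists i, (i <= m)%nat /\ hull_support n m p x = dot n (p i) x.
Proof.
  induction m as [|m [i [Hi E]]]; simpl; [now exists 0%nat|].
  unfold Rmax. destruct Rle_dec; [now exists (S m)|exists i; auto].
Qed.

(** The sum is a convenient common bound for the norms of the points; it serves both as Lipschitz
    constant and as growth constant of [hull_support]. *)
Definition radius_bound (n m : nat) (p : nat -> vec) : R := sum_lt (S m) (fun i => norm n (p i)).

Lemma radius_bound_ge n m p i : (i <= m)%nat -> norm n (p i) <= radius_bound n m p.
Proof.
  intros Hi. apply (sum_lt_term_le (S m) (fun i => norm n (p i))); [|lia].
  intros. apply norm_nonneg.
Qed.

Lemma radius_bound_nonneg n m p : 0 <= radius_bound n m p.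
Proof. apply sum_lt_nonneg. intros. apply norm_nonneg. Qed.

Lemma hull_support_bound n m p x :
  Rabs (hull_support n m p x) <= radius_bound n m p * norm n x.
Proof.
  destruct (hull_support_attained n m p x) as [i [Hi ->]].
  eapply Rle_trans; [apply cauchy_schwarz|].
  apply Rmult_le_compat_r; [apply norm_nonneg|now apply radius_bound_ge].
Qed.

Lemma hull_support_lipschitz n m p : lipschitz n (radius_bound n m p) (hull_support n m p).
Proof.
  assert (H : forall x y, hull_support n m p x - hull_support n m p y <=
    radius_bound n m p * l1dist n x y).
  { intros x y. destruct (hull_support_attained n m p x) as [i [Hi ->]].
    assert (A := hull_support_ge n m p y i Hi).
    assert (B := dot_lipschitz n (p i) x y). cbv beta in B.
    assert (B' := Rle_abs (dot n (p i) x - dot n (p i) y)).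
    assert (C := Rmult_le_compat_r _ _ _ (l1dist_nonneg n x y) (radius_bound_ge n m p i Hi)).
    lra. }
  intros x y. apply Rabs_le. split; [|apply H].
  assert (E : l1dist n y x = l1dist n x y).
  { apply sum_lt_ext. intros. apply Rabs_minus_sym. }
  specialize (H y x). rewrite E in H. lra.
Qed.

Lemma dot_scal_r n v a x : dot n v (affine a zero_vec x) = a * dot n v x.
Proof.
  unfold dot. rewrite <- sum_lt_scal. apply sum_lt_ext.
  intros. unfold affine, zero_vec. ring.
Qed.

Lemma hull_support_scal n m p a x : 0 < a ->
  hull_support n m p (affine a zero_vec x) = a * hull_support n m p x.
Proof.
  intros Ha. induction m; cbn [hull_support]; [apply dot_scal_r|].
  rewrite IHm, dot_scal_r, RmaxRmult by lra. reflexivity.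
Qed.

(** Thus h(-x) is itself a support function, that of the reflected points, and every bound on
    [hull_support] applies to it. *)
Lemma hull_support_opp n m p x :
  hull_support n m (fun i => opp_vec (p i)) x = hull_support n m p (opp_vec x).
Proof.
  assert (E : forall v, dot n (opp_vec v) x = dot n v (opp_vec x)).
  { intros v. apply sum_lt_ext. intros. unfold opp_vec. ring. }
  induction m; cbn [hull_support]; [apply E|]. now rewrite IHm, E.
Qed.

Lemma sum_lt_exchange n m (F : nat -> nat -> R) :
  sum_lt n (fun i => sum_lt m (F i)) = sum_lt m (fun j => sum_lt n (fun i => F i j)).
Proof.
  induction n.
  - rewrite (sum_lt_ext m _ (fun _ => 0)) by reflexivity. now rewrite sum_lt_0.
  - rewrite sum_lt_S, IHn, <- sum_lt_plus. apply sum_lt_ext. intros. now rewrite sum_lt_S.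
Qed.

Lemma sum_lt_single N i c : (i < N)%nat ->
  sum_lt N (fun j => (if Nat.eqb j i then 1 else 0) * c j) = c i.
Proof.
  induction N; intros Hi; [lia|]. rewrite sum_lt_S.
  destruct (Nat.eqb_spec N i) as [->|Hne].
  - rewrite (sum_lt_ext i _ (fun _ => 0)), sum_lt_0; [ring|].
    intros j Hj. destruct (Nat.eqb_spec j i); [lia|ring].
  - rewrite IHN by lia. ring.
Qed.

(** A linear functional on a convex combination is at most its maximum over the points, and weights
    concentrated on a maximizing point attain it. *)
Lemma hull_support_value n m p u :
  is_support_value n (conv n (S m) p) u (hull_support n m p u).
Proof.
  split.
  - intros t (x & (lam & Hpos & Hsum & Hx) & ->).
    assert (E : dot n x u = sum_lt (S m) (fun i => lam i * dot n (p i) u)).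
    { unfold dot. rewrite (sum_lt_ext n _ (fun j => sum_lt (S m) (fun i => lam i * (p i j * u j)))).
      - rewrite sum_lt_exchange. apply sum_lt_ext. intros i _. apply sum_lt_scal.
      - intros j Hj. rewrite Hx by assumption. rewrite Rmult_comm, <- sum_lt_scal.
        apply sum_lt_ext. intros. ring. }
    rewrite E, <- (Rmult_1_l (hull_support n m p u)), <- Hsum, Rmult_comm, <- sum_lt_scal.
    apply sum_lt_le. intros i Hi. rewrite (Rmult_comm (hull_support n m p u)).
    apply Rmult_le_compat_l; [auto|]. apply hull_support_ge. lia.
  - intros b Hb. destruct (hull_support_attained n m p u) as [i [Hi ->]].
    apply Hb. exists (p i). split; [|reflexivity].
    exists (fun j => if Nat.eqb j i then 1 else 0). split; [|split].
    + intros j _. destruct (Nat.eqb j i); lra.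
    + transitivity (sum_lt (S m) (fun j => (if Nat.eqb j i then 1 else 0) * 1)).
      * apply sum_lt_ext. intros. ring.
      * apply (sum_lt_single (S m) i (fun _ => 1)). lia.
    + intros j _. now rewrite (sum_lt_single (S m) i (fun k => p k j)) by lia.
Qed.

Lemma norm_quotient_bound n P h x : 0 <= P -> Rabs h <= P * norm n x -> - P <= h / norm n x <= P.
Proof.
  intros HP HB. assert (Hx := norm_nonneg n x). destruct (Req_dec (norm n x) 0) as [E|E].
  - rewrite E, Rmult_0_r in HB.
    assert (h = 0) as -> by (unfold Rabs in HB; destruct Rcase_abs; lra).
    unfold Rdiv. rewrite Rmult_0_l. lra.
  - apply Rabs_le_between in HB.
    assert (E' : h / norm n x * norm n x = h) by (field; lra).
    split; (apply Rmult_le_reg_r with (norm n x); [lra|]); lra.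
Qed.

(** The quotient ranges over [-P, P]; the map t -> (t + P) / (2 P + 1) brings it into [0, 1], where
    clamping is the identity, and linearity undoes the map. The [+ 1] covers P = 0. *)
Lemma jintegral_angular_mean n P H : (1 <= n)%nat -> 0 <= P ->
  lipschitz n P H -> (forall x, Rabs (H x) <= P * norm n x) ->
  exists I, jintegral n (fun x => H x / norm n x * indic (ball n zero_vec 1) x) I.
Proof.
  intros Hn HP HL HB.
  set (Psi := fun t => clamp01 ((t + P) / (2 * P + 1))).
  assert (Hi : 0 < / (2 * P + 1)) by (apply Rinv_0_lt_compat; lra).
  destruct (jintegral_angular_unit n P H Psi (/ (2 * P + 1))) as [I HI]; auto; try lra.
  - intros t. apply clamp01_bounds.
  - intros s t. unfold Psi. eapply Rle_trans; [apply clamp01_dist|].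
    replace ((s + P) / (2 * P + 1) - (t + P) / (2 * P + 1)) with (/ (2 * P + 1) * (s - t))
      by (field; lra).
    rewrite Rabs_mult, Rabs_pos_eq by lra. apply Rle_refl.
  - destruct (jintegral_unit_ball n) as [D HD].
    exists ((2 * P + 1) * I - P * D).
    eapply jintegral_ext;
      [|exact (jintegral_minus n _ _ _ _ (jintegral_scal n (2 * P + 1) _ _ HI)
                 (jintegral_scal n P _ _ HD))].
    intros x. cbv beta. unfold Psi.
    assert (HQ := norm_quotient_bound n P (H x) x HP (HB x)).
    set (t := H x / norm n x) in *.
    rewrite clamp01_id; [field; lra|]. split.
    + apply Rmult_le_pos; lra.
    + apply Rmult_le_reg_r with (2 * P + 1); [lra|].
      replace ((t + P) / (2 * P + 1) * (2 * P + 1)) with (t + P) by (field; lra). lra.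
Qed.

(** * Balls seen from infinity *)

Lemma dot_minus_self n x c :
  dot n (fun i => x i - c i) (fun i => x i - c i) = dot n x x - 2 * dot n c x + dot n c c.
Proof.
  replace (fun i => x i - c i) with (fun i => -1 * c i + x i)
    by (apply functional_extensionality; intros; ring).
  rewrite dot_affine_l, !dot_affine_r, (dot_sym n x c). ring.
Qed.

Lemma dot_opp_l n c x : dot n (opp_vec c) x = - dot n c x.
Proof.
  replace (- dot n c x) with (-1 * dot n c x) by ring.
  unfold dot. rewrite <- sum_lt_scal. apply sum_lt_ext. intros. unfold opp_vec. ring.
Qed.

(** Take the point maximizing -<p_i, x>: Cauchy-Schwarz gives |x|^2 - <p_i, x> = <x - p_i, x> <= r
    |x|, and division by |x| yields the claim. *)
Lemma inter_balls_outer n m p r x : 0 <= r -> inter_balls n (S m) p r x ->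
  norm n x + hull_support n m (fun i => opp_vec (p i)) x / norm n x <= r.
Proof.
  intros Hr H. assert (Hx := norm_nonneg n x).
  destruct (hull_support_attained n m (fun i => opp_vec (p i)) x) as [i [Hi ->]].
  rewrite dot_opp_l.
  destruct (Req_dec (norm n x) 0) as [E|E].
  - assert (B := cauchy_schwarz n (p i) x). rewrite E, Rmult_0_r in B.
    assert (dot n (p i) x = 0) as -> by (unfold Rabs in B; destruct Rcase_abs; lra).
    rewrite E. unfold Rdiv. rewrite Ropp_0, Rmult_0_l. lra.
  - assert (Hb : ball n (p i) r x) by (apply H; lia). unfold ball in Hb.
    assert (B := cauchy_schwarz n (fun j => x j - p i j) x).
    assert (E' : dot n (fun j => x j - p i j) x = norm n x * norm n x - dot n (p i) x).
    { rewrite norm_sqr. replace (fun j => x j - p i j) with (fun j => -1 * p i j + x j)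
        by (apply functional_extensionality; intros; ring).
      rewrite dot_affine_l. ring. }
    rewrite E' in B. assert (B' := Rle_abs (norm n x * norm n x - dot n (p i) x)).
    apply Rmult_le_reg_r with (norm n x); [lra|].
    replace ((norm n x + - dot n (p i) x / norm n x) * norm n x)
      with (norm n x * norm n x - dot n (p i) x) by (field; lra).
    assert (norm n (fun j => x j - p i j) * norm n x <= r * norm n x)
      by (apply Rmult_le_compat_r; lra).
    lra.
Qed.

(** With c = <p_i, x> / |x|, |x - p_i|^2 = (|x| - c)^2 + |p_i|^2 - c^2 <= (r - eta)^2 + P^2, and
    this is at most r^2 because P^2 and eta^2 are both at most eta r. *)
Lemma inter_balls_inner n m p r eta x : 0 < eta -> eta + radius_bound n m p <= r ->
  radius_bound n m p * radius_bound n m p <= eta * r ->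
  norm n x + hull_support n m (fun i => opp_vec (p i)) x / norm n x <= r - eta ->
  inter_balls n (S m) p r x.
Proof.
  intros He Hr Hr2 H i Hi. assert (Hx := norm_nonneg n x).
  assert (HP := radius_bound_ge n m p i ltac:(lia)).
  assert (HP0 := norm_nonneg n (p i)).
  set (P := radius_bound n m p) in *. unfold ball.
  destruct (Req_dec (norm n x) 0) as [E|E].
  - rewrite (norm_ext n _ (opp_vec (p i))); [rewrite norm_opp_vec; lra|].
    intros j Hj. unfold opp_vec. rewrite (norm_0_coord n x j E Hj). ring.
  - assert (A := hull_support_ge n m (fun i => opp_vec (p i)) x i ltac:(lia)).
    cbv beta in A. rewrite dot_opp_l in A.
    apply Rsqr_incr_0_var; [|lra]. unfold Rsqr.
    rewrite norm_sqr, dot_minus_self, <- !norm_sqr.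
    set (c := dot n (p i) x / norm n x).
    assert (Ec : dot n (p i) x = c * norm n x) by (unfold c; field; lra).
    assert (Hc : c <= P).
    { assert (B := cauchy_schwarz n (p i) x). assert (B' := Rle_abs (dot n (p i) x)).
      rewrite Ec in *. apply Rmult_le_reg_r with (norm n x); [lra|].
      apply Rle_trans with (norm n (p i) * norm n x); [lra|].
      apply Rmult_le_compat_r; lra. }
    assert (HT : norm n x - c <= r - eta).
    { assert (D : - c <= hull_support n m (fun i => opp_vec (p i)) x / norm n x); [|lra].
      apply Rmult_le_reg_r with (norm n x); [lra|].
      unfold Rdiv. rewrite Rmult_assoc, Rinv_l by assumption. lra. }
    rewrite Ec.
    (* Squaring also needs the lower bound |x| - c >= -P >= -(r - eta), which is where
       [eta + P <= r] enters. *)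
    assert (HT2 : (norm n x - c) * (norm n x - c) <= (r - eta) * (r - eta)) by nra.
    assert (norm n (p i) * norm n (p i) <= P * P) by nra.
    nra.
Qed.

(** * Expansion of powers and a partition of unity in the direction *)

(** The remainders satisfy R_{n+1} = (1 - t) R_n + n t^2. As |1 - t| <= 2 and n <= 4^n, the bound
    4^n t^2 reproduces itself. *)
Lemma pow_one_minus_expand n t : Rabs t <= 1 ->
  Rabs ((1 - t) ^ n - 1 + INR n * t) <= 4 ^ n * (t * t).
Proof.
  intros Ht. induction n.
  - simpl. replace (1 - 1 + 0 * t) with 0 by ring. rewrite Rabs_R0. nra.
  - rewrite S_INR, <- !tech_pow_Rmult.
    replace ((1 - t) * (1 - t) ^ n - 1 + (INR n + 1) * t) with
      ((1 - t) * ((1 - t) ^ n - 1 + INR n * t) + INR n * (t * t)) by ring.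
    eapply Rle_trans; [apply Rabs_triang|].
    rewrite (Rabs_mult (1 - t)), (Rabs_mult (INR n)).
    assert (HN : INR n <= 4 ^ n).
    { clear. induction n; [simpl; lra|]. rewrite S_INR, <- tech_pow_Rmult.
      assert (1 <= 4 ^ n) by (apply pow_R1_Rle; lra). lra. }
    assert (H2 : Rabs (1 - t) <= 2).
    { apply Rabs_le_between in Ht. apply Rabs_le. lra. }
    rewrite (Rabs_pos_eq (INR n)) by apply pos_INR.
    rewrite (Rabs_pos_eq (t * t)) by apply Rle_0_sqr.
    assert (0 <= t * t) by apply Rle_0_sqr.
    assert (A1 : Rabs (1 - t) * Rabs ((1 - t) ^ n - 1 + INR n * t) <= 2 * (4 ^ n * (t * t))).
    { apply Rmult_le_compat; auto; apply Rabs_pos. }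
    assert (INR n * (t * t) <= 4 ^ n * (t * t)) by (now apply Rmult_le_compat_r).
    assert (0 <= 4 ^ n * (t * t)) by (apply Rmult_le_pos; [apply pow_le; lra|assumption]).
    lra.
Qed.

Lemma pow_minus_expand n r b B : (1 <= n)%nat -> 0 < r -> Rabs b <= B -> B <= r ->
  Rabs ((r - b) ^ n - (r ^ n - INR n * b * r ^ (n - 1))) <= 4 ^ n * (B * B) / r * r ^ (n - 1).
Proof.
  intros Hn Hr Hb HB. destruct n as [|k]; [lia|].
  replace (S k - 1)%nat with k by lia.
  assert (Hir : 0 < / r) by now apply Rinv_0_lt_compat.
  assert (Hb0 := Rabs_pos b).
  assert (Ht : Rabs (b / r) <= 1).
  { unfold Rdiv. rewrite Rabs_mult, (Rabs_pos_eq (/ r)) by lra.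
    apply Rmult_le_reg_r with r; [assumption|]. rewrite Rmult_assoc, Rinv_l; lra. }
  assert (A := pow_one_minus_expand (S k) (b / r) Ht).
  assert (Hrp : 0 < r ^ S k) by now apply pow_lt.
  assert (Hrk : 0 < r ^ k) by now apply pow_lt.
  replace ((r - b) ^ S k - (r ^ S k - INR (S k) * b * r ^ k)) with
    (r ^ S k * ((1 - b / r) ^ S k - 1 + INR (S k) * (b / r))).
  - rewrite Rabs_mult, (Rabs_pos_eq (r ^ S k)) by lra.
    eapply Rle_trans; [apply Rmult_le_compat_l; [lra|exact A]|].
    replace (r ^ S k * (4 ^ S k * (b / r * (b / r)))) with (4 ^ S k / r * r ^ k * (b * b))
      by (rewrite <- (tech_pow_Rmult r k); field; lra).
    replace (4 ^ S k * (B * B) / r * r ^ k) with (4 ^ S k / r * r ^ k * (B * B))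
      by (unfold Rdiv; ring).
    apply Rmult_le_compat_l.
    + apply Rmult_le_pos; [|lra]. apply Rmult_le_pos; [apply pow_le|]; lra.
    + replace (b * b) with (Rabs b * Rabs b)
        by (rewrite <- Rabs_mult, Rabs_pos_eq; [reflexivity|apply Rle_0_sqr]).
      nra.
  - replace (r - b) with (r * (1 - b / r)) by (field; lra).
    rewrite Rpow_mult_distr, <- (tech_pow_Rmult r k). field. lra.
Qed.

Definition level (a eta : R) (j : nat) : R := a + INR j * eta.

Definition ramp (a eta : R) (j : nat) (t : R) : R := clamp01 ((t - level a eta j) / eta).

(* The functions [level_weight a eta j] form a partition of unity subordinate to the
   intervals [[level a eta j, level a eta j + 2 * eta]]. *)
Definition level_weight (a eta : R) (j : nat) (t : R) : R :=
  ramp a eta j t - ramp a eta (S j) t.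

Lemma level_S a eta j : level a eta (S j) = level a eta j + eta.
Proof. unfold level. rewrite S_INR. ring. Qed.

Lemma ramp_1 a eta j t : 0 < eta -> level a eta j + eta <= t -> ramp a eta j t = 1.
Proof.
  intros He H. apply clamp01_1. apply Rmult_le_reg_r with eta; [assumption|].
  unfold Rdiv. rewrite Rmult_assoc, Rinv_l; lra.
Qed.

Lemma ramp_0 a eta j t : 0 < eta -> t <= level a eta j -> ramp a eta j t = 0.
Proof.
  intros He H. apply clamp01_0. apply Rmult_le_reg_r with eta; [assumption|].
  unfold Rdiv. rewrite Rmult_assoc, Rinv_l; lra.
Qed.

Lemma level_weight_nonneg a eta j t : 0 < eta -> 0 <= level_weight a eta j t.
Proof.
  intros He. unfold level_weight.
  assert (ramp a eta (S j) t <= ramp a eta j t); [|lra].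
  apply clamp01_le. rewrite level_S.
  apply Rmult_le_compat_r; [left; now apply Rinv_0_lt_compat|lra].
Qed.

Lemma level_weight_support a eta j t : 0 < eta ->
  level_weight a eta j t = 0 \/ level a eta j <= t <= level a eta j + 2 * eta.
Proof.
  intros He. unfold level_weight.
  destruct (Rle_dec t (level a eta j)).
  - left. rewrite !ramp_0; rewrite ?level_S; lra.
  - destruct (Rle_dec (level a eta j + 2 * eta) t); [|right; lra].
    left. rewrite !ramp_1; rewrite ?level_S; lra.
Qed.

(** The sum telescopes to the first ramp minus ramp [K]. The first ramp reaches 1 only one step
    above [a], and ramp [K] is still 0 up to its own level. *)
Lemma level_weight_sum a eta K t : 0 < eta -> a + eta <= t <= level a eta K ->
  sum_lt K (fun j => level_weight a eta j t) = 1.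
Proof.
  intros He Ht. unfold level_weight.
  rewrite (sum_lt_telescope K (fun j => ramp a eta j t)), ramp_1, ramp_0; try lra.
  unfold level. simpl. lra.
Qed.

(** Each weight is a difference of two ramps, to which [jintegral_angular] applies. The constants
    are fixed before [s], so one family [c] serves all radii. *)
Lemma jintegral_level_weight n P H a eta : (1 <= n)%nat -> 0 <= P -> 0 < eta ->
  lipschitz n P H -> (forall x, Rabs (H x) <= P * norm n x) ->
  (forall a x, 0 < a -> H (affine a zero_vec x) = a * H x) ->
  exists c : nat -> R, forall j s, 0 < s ->
    jintegral n (fun x => level_weight a eta j (H x / norm n x) * indic (ball n zero_vec s) x)
      (s ^ n * c j).
Proof.
  intros Hn HP He HL HB HH.
  assert (Hie : 0 < / eta) by now apply Rinv_0_lt_compat.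
  assert (R : forall j, exists d, forall s, 0 < s ->
    jintegral n (fun x => ramp a eta j (H x / norm n x) * indic (ball n zero_vec s) x) (s ^ n * d)).
  { intros j. apply jintegral_angular with P (/ eta); auto; try lra.
    - intros t. apply clamp01_bounds.
    - intros u v. unfold ramp. eapply Rle_trans; [apply clamp01_dist|].
      replace ((u - level a eta j) / eta - (v - level a eta j) / eta) with (/ eta * (u - v))
        by (field; lra).
      rewrite Rabs_mult, Rabs_pos_eq by lra. apply Rle_refl. }
  exists (fun j => proj1_sig (constructive_indefinite_description _ (R j)) -
                   proj1_sig (constructive_indefinite_description _ (R (S j)))).
  intros j s Hs.
  destruct (constructive_indefinite_description _ (R j)) as [d Hd].
  destruct (constructive_indefinite_description _ (R (S j))) as [d' Hd']. simpl.
  rewrite Rmult_minus_distr_l.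
  eapply jintegral_ext; [|exact (jintegral_minus n _ _ _ _ (Hd s Hs) (Hd' s Hs))].
  intros x. unfold level_weight. ring.
Qed.

Lemma inter_balls_expansion n m p delta M0 (V : R -> R) : (1 <= n)%nat ->
  jintegral n (indic (ball n zero_vec 1)) delta ->
  jintegral n (fun x => hull_support n m p x / norm n x * indic (ball n zero_vec 1) x) M0 ->
  (forall r, 0 < r -> jintegral n (indic (inter_balls n (S m) p r)) (V r)) ->
  forall eps, 0 < eps -> exists R0, forall r, R0 <= r ->
    Rabs (V r - (delta * r ^ n - INR n * M0 * r ^ (n - 1))) <= eps * r ^ (n - 1).
Proof.
  intros Hn Hdelta HM HV eps Heps.
  set (q := fun i => opp_vec (p i)).
  set (g := fun x => hull_support n m q x / norm n x).
  (* The substitution x -> -x turns the mean of h(x/|x|) into that of h(-x/|x|), the function that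
     governs the intersection of the balls. *)
  assert (HMq : jintegral n (fun x => g x * indic (ball n zero_vec 1) x) M0).
  { eapply jintegral_ext; [|exact (jintegral_opp_vec n _ _ HM)].
    intros x. cbv beta. unfold g, q. rewrite hull_support_opp, norm_opp_vec. f_equal.
    apply indic_iff. rewrite !ball_zero, norm_opp_vec. tauto. }
  clear HM.
  assert (Hd0 : 0 <= delta).
  { replace 0 with (0 * delta) by ring.
    eapply jintegral_le; [|apply jintegral_scal; exact Hdelta|exact Hdelta].
    intros x. cbv beta. generalize (indic_bounds (ball n zero_vec 1) x). lra. }
  set (P := radius_bound n m p).
  assert (EP : radius_bound n m q = P).
  { apply sum_lt_ext. intros. apply norm_opp_vec. }
  assert (HP : 0 <= P) by apply radius_bound_nonneg.
  assert (HnR := pos_INR n).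
  assert (Hnd : 0 <= INR n * delta) by (now apply Rmult_le_pos).
  (* Discretization costs at most 3 eta n delta, which this choice keeps below eps / 2; the other
     half is left for the second-order error. *)
  set (eta := eps / (6 * (INR n * delta) + 1)).
  assert (He : 0 < eta) by (apply Rdiv_lt_0_compat; lra).
  assert (Heta : 3 * eta * (INR n * delta) <= eps / 2).
  { assert (E : eta * (6 * (INR n * delta) + 1) = eps) by (unfold eta; field; lra). lra. }
  (* The direction function takes values in [-P, P]. Starting one step below -P makes the first ramp
     equal to 1 on this range, and [K] is taken so large that level [K] lies above P. *)
  set (a := - P - eta).
  destruct (INR_archimed eta (2 * P + eta)) as [K HK]; [assumption|].
  assert (HKpos : (0 < K)%nat).
  { destruct K; [|lia]. simpl in HK. lra. }
  destruct (jintegral_level_weight n P (hull_support n m q) a eta) as [c Hc]; auto.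
  { rewrite <- EP. apply hull_support_lipschitz. }
  { intros x. rewrite <- EP. apply hull_support_bound. }
  { intros. now apply hull_support_scal. }
  fold g in Hc.
  set (phi := fun j x => level_weight a eta j (g x)).
  assert (Hphi0 : forall j x, 0 <= phi j x) by (intros; now apply level_weight_nonneg).
  assert (Hphi1 : forall x, sum_lt K (fun j => phi j x) = 1).
  { intros x. apply level_weight_sum; [assumption|].
    assert (B := hull_support_bound n m q x). rewrite EP in B.
    apply norm_quotient_bound in B; [|assumption]. fold (g x) in B.
    unfold level, a. lra. }
  assert (Hphis : forall j x, phi j x = 0 \/ level a eta j <= g x <= level a eta j + 2 * eta)
    by (intros; now apply level_weight_support).
  assert (Hc' : forall j s, 0 < s ->
    jintegral n (fun x => phi j x * indic (ball n zero_vec s) x) (s ^ n * c j)) by exact Hc.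
  clearbody phi. clear Hc.
  assert (Hc1 : forall j, jintegral n (fun x => phi j x * indic (ball n zero_vec 1) x) (c j)).
  { intros j. generalize (Hc' j 1 Rlt_0_1). now rewrite pow1, Rmult_1_l. }
  assert (Hcpos : forall j, 0 <= c j).
  { intros j. replace 0 with (0 * c j) by ring.
    eapply jintegral_le; [|apply jintegral_scal; exact (Hc1 j)|exact (Hc1 j)].
    intros x. cbv beta. rewrite Rmult_0_l. apply Rmult_le_pos; [auto|apply indic_bounds]. }
  assert (Hcsum : sum_lt K c = delta).
  { eapply jintegral_unique; [|exact Hdelta].
    eapply jintegral_ext; [|exact (jintegral_sum n K _ c HKpos (fun j _ => Hc1 j))].
    intros x. cbv beta.
    rewrite (sum_lt_ext K _ (fun j => indic (ball n zero_vec 1) x * phi j x)) by (intros; ring).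
    rewrite sum_lt_scal, Hphi1. ring. }
  (* [S0] is a lower sum for [M0]: on the support of a weight, g exceeds the level by at most
     [2 * eta], so the total defect is at most [2 * eta * delta]. *)
  set (S0 := sum_lt K (fun j => level a eta j * c j)).
  assert (HS : forall (w : nat -> R),
    jintegral n (fun x => sum_lt K (fun j => w j * (phi j x * indic (ball n zero_vec 1) x)))
      (sum_lt K (fun j => w j * c j))).
  { intros w. apply (jintegral_sum n K (fun j x => w j * (phi j x * indic (ball n zero_vec 1) x)));
      [assumption|]. intros j _. now apply jintegral_scal. }
  assert (Hg : forall x, g x * indic (ball n zero_vec 1) x =
    sum_lt K (fun j => g x * (phi j x * indic (ball n zero_vec 1) x))).
  { intros x. rewrite sum_lt_scal.
    rewrite (sum_lt_ext K _ (fun j => indic (ball n zero_vec 1) x * phi j x)) by (intros; ring).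
    rewrite sum_lt_scal, Hphi1. ring. }
  assert (HS1 : S0 <= M0).
  { eapply jintegral_le; [|exact (HS (level a eta))|exact HMq].
    intros x. cbv beta. rewrite Hg. apply sum_lt_le. intros j _.
    destruct (Hphis j x) as [->|B]; [lra|]. apply Rmult_le_compat_r; [|lra].
    apply Rmult_le_pos; [auto|apply indic_bounds]. }
  assert (HS2 : M0 <= S0 + 2 * eta * delta).
  { replace (S0 + 2 * eta * delta) with (sum_lt K (fun j => (level a eta j + 2 * eta) * c j)).
    2:{ unfold S0. rewrite <- Hcsum, <- sum_lt_scal, <- sum_lt_plus.
        apply sum_lt_ext. intros. ring. }
    eapply jintegral_le; [|exact HMq|exact (HS (fun j => level a eta j + 2 * eta))].
    intros x. cbv beta. rewrite Hg. apply sum_lt_le. intros j _.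
    destruct (Hphis j x) as [->|B]; [lra|]. apply Rmult_le_compat_r; [|lra].
    apply Rmult_le_pos; [auto|apply indic_bounds]. }
  (* A common bound for the absolute values of all shifts used below, both the levels and the levels
     plus [3 * eta]. *)
  set (B := P + eta + INR K * eta + 3 * eta).
  assert (HKe : 0 <= INR K * eta) by (apply Rmult_le_pos; [apply pos_INR|lra]).
  assert (Hlev : forall j, (j < K)%nat -> - (P + eta) <= level a eta j <= INR K * eta).
  { intros j Hj. unfold level, a.
    assert (0 <= INR j * eta) by (apply Rmult_le_pos; [apply pos_INR|lra]).
    assert (INR j * eta <= INR K * eta) by (apply Rmult_le_compat_r; [lra|apply le_INR; lia]).
    lra. }
  set (E := 4 ^ n * (B * B)).
  assert (HE : 0 <= E).
  { apply Rmult_le_pos; [apply pow_le; lra|apply Rle_0_sqr]. }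
  (* [B + 1] makes all radii positive and the power expansion valid, [P * P / eta] serves the inner
     inclusion, and the last term brings the second-order error below eps / 2. *)
  exists (B + 1 + P * P / eta + 2 * (delta * E) / eps). intros r Hr.
  assert (HPe : 0 <= P * P / eta).
  { apply Rmult_le_pos; [apply Rle_0_sqr|left; now apply Rinv_0_lt_compat]. }
  assert (HdE : 0 <= delta * E) by (now apply Rmult_le_pos).
  assert (HdEe : 0 <= 2 * (delta * E) / eps).
  { apply Rmult_le_pos; [lra|left; now apply Rinv_0_lt_compat]. }
  assert (HBr : B + 1 <= r) by lra.
  assert (Hr0 : 0 < r) by (unfold B in HBr; lra).
  assert (HPr : P * P <= eta * r).
  { replace (P * P) with (eta * (P * P / eta)) by (field; lra).
    apply Rmult_le_compat_l; [lra|]. unfold B in Hr. lra. }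
  assert (HEr : delta * (E / r) <= eps / 2).
  { apply Rmult_le_reg_r with r; [assumption|].
    replace (delta * (E / r) * r) with (eps / 2 * (2 * (delta * E) / eps)) by (field; lra).
    apply Rmult_le_compat_l; [lra|]. unfold B in Hr. lra. }
  set (rn := r ^ (n - 1)).
  assert (Hrn : 0 < rn) by now apply pow_lt.
  assert (HSr : forall b, (forall j, (j < K)%nat -> 0 < r - b j) ->
    jintegral n (fun x => sum_lt K (fun j => phi j x * indic (ball n zero_vec (r - b j)) x))
      (sum_lt K (fun j => (r - b j) ^ n * c j))).
  { intros b Hb.
    apply (jintegral_sum n K (fun j x => phi j x * indic (ball n zero_vec (r - b j)) x));
      [assumption|]. intros j Hj. apply Hc', Hb, Hj. }
  assert (Hexp : forall b, (forall j, (j < K)%nat -> Rabs (b j) <= B) ->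
    Rabs (sum_lt K (fun j => (r - b j) ^ n * c j) -
      (delta * r ^ n - INR n * sum_lt K (fun j => b j * c j) * rn)) <= delta * (E / r) * rn).
  { intros b Hb.
    replace (sum_lt K (fun j => (r - b j) ^ n * c j) -
      (delta * r ^ n - INR n * sum_lt K (fun j => b j * c j) * rn)) with
      (sum_lt K (fun j => c j * ((r - b j) ^ n - (r ^ n - INR n * b j * rn)))).
    - eapply Rle_trans; [apply sum_lt_Rabs|].
      replace (delta * (E / r) * rn) with (sum_lt K (fun j => (E / r * rn) * c j))
        by (rewrite sum_lt_scal, Hcsum; ring).
      apply sum_lt_le. intros j Hj. rewrite Rabs_mult, Rabs_pos_eq, Rmult_comm by auto.
      apply Rmult_le_compat_r; [auto|].
      unfold rn, E. apply pow_minus_expand; auto; lra.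
    - rewrite (sum_lt_ext K _ (fun j => (r - b j) ^ n * c j +
        ((- r ^ n) * c j + INR n * rn * (b j * c j)))) by (intros; ring).
      rewrite sum_lt_plus, (sum_lt_plus K (fun j => - r ^ n * c j)), !sum_lt_scal, Hcsum. ring. }
  assert (Hup : V r <= sum_lt K (fun j => (r - level a eta j) ^ n * c j)).
  { eapply jintegral_le; [|exact (HV r Hr0)|apply HSr].
    - intros x. cbv beta. destruct (classic (inter_balls n (S m) p r x)) as [Hx|Hx].
      + rewrite indic_in by assumption. rewrite <- (Hphi1 x). apply sum_lt_le. intros j _.
        destruct (Hphis j x) as [->|Hg']; [lra|].
        (* Where the weight is nonzero, g is at least the level, so |x| <= r - g(x) places x in the
           ball of radius r minus the level. *)
        assert (Ho := inter_balls_outer n m p r x ltac:(lra) Hx).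
        fold q in Ho. fold (g x) in Ho.
        rewrite indic_in; [lra|]. apply ball_zero. lra.
      + rewrite indic_out by assumption. apply sum_lt_nonneg. intros j _.
        apply Rmult_le_pos; [auto|apply indic_bounds].
    - intros j Hj. specialize (Hlev j Hj). unfold B in HBr. lra. }
  assert (Hlow : sum_lt K (fun j => (r - (level a eta j + 3 * eta)) ^ n * c j) <= V r).
  { eapply jintegral_le; [|apply HSr|exact (HV r Hr0)].
    - intros x. cbv beta. destruct (classic (inter_balls n (S m) p r x)) as [Hx|Hx].
      + rewrite indic_in by assumption. rewrite <- (Hphi1 x). apply sum_lt_le. intros j _.
        specialize (Hphi0 j x).
        generalize (indic_bounds (ball n zero_vec (r - (level a eta j + 3 * eta))) x). nra.
      + rewrite indic_out by assumption. rewrite <- (sum_lt_0 K). apply sum_lt_le. intros j _.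
        destruct (Hphis j x) as [->|Hg']; [lra|].
        (* If x lay in this ball, then g(x) <= level + 2 eta would give |x| + g(x) <= r - eta, and
           the inner inclusion would put x in the intersection. *)
        rewrite indic_out; [lra|]. rewrite ball_zero. intros Hb. apply Hx.
        apply inter_balls_inner with eta; auto.
        * fold P. unfold B in HBr. lra.
        * fold q. fold (g x). lra.
    - intros j Hj. specialize (Hlev j Hj). unfold B in HBr. lra. }
  assert (X1 := Hexp (level a eta)).
  assert (X2 := Hexp (fun j => level a eta j + 3 * eta)). cbv beta in X2.
  fold S0 in X1.
  replace (sum_lt K (fun j => (level a eta j + 3 * eta) * c j)) with (S0 + 3 * eta * delta) in X2.
  2:{ unfold S0. rewrite <- Hcsum, <- sum_lt_scal, <- sum_lt_plus.
      apply sum_lt_ext. intros. ring. }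
  specialize (X1 ltac:(intros j Hj; specialize (Hlev j Hj); apply Rabs_le; unfold B; lra)).
  specialize (X2 ltac:(intros j Hj; specialize (Hlev j Hj); apply Rabs_le; unfold B; lra)).
  apply Rabs_le_between in X1, X2.
  assert (Y0 : delta * (E / r) * rn <= eps / 2 * rn) by (apply Rmult_le_compat_r; lra).
  assert (Y1 : 3 * eta * (INR n * delta) * rn <= eps / 2 * rn) by (apply Rmult_le_compat_r; lra).
  assert (Hnr : 0 <= INR n * rn) by (apply Rmult_le_pos; lra).
  assert (Y2 : INR n * rn * S0 <= INR n * rn * M0) by (now apply Rmult_le_compat_l).
  assert (Y3 : INR n * rn * M0 <= INR n * rn * (S0 + 2 * eta * delta))
    by (now apply Rmult_le_compat_l).
  assert (Y4 : 0 <= eta * (INR n * delta) * rn).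
  { apply Rmult_le_pos; [|lra]. apply Rmult_le_pos; lra. }
  (* Replacing [S0] by [M0] costs 2 eta n delta [rn] in the upper bound; the lower bound loses 3 eta
     n delta [rn] through the shift. [Y4] lets the larger loss cover both. *)
  apply Rabs_le. lra.
Qed.

Theorem theorem4 (n N : nat) (p : nat -> vec)
  (Hn : (2 <= n)%nat) (HN : (1 <= N)%nat) :
  exists (delta M : R) (V : R -> R),
    is_volume n (ball n zero_vec 1) delta /\
    is_Mn n (conv n N p) M /\
    (forall r, 0 < r -> is_volume n (inter_balls n N p r) (V r)) /\
    (forall eps, 0 < eps -> exists R0, forall r, R0 <= r ->
       Rabs (V r - (delta * r ^ n - M * r ^ (n - 1))) <= eps * r ^ (n - 1)).
Proof.
  destruct N as [|m]; [lia|].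
  destruct (jintegral_unit_ball n) as [delta Hdelta].
  destruct (jintegral_angular_mean n (radius_bound n m p) (hull_support n m p)) as [M0 HM0];
    [lia|apply radius_bound_nonneg|apply hull_support_lipschitz|apply hull_support_bound|].
  (* [V] must be a total function of the radius, while the integrals are shown to exist for r > 0
     only; [epsilon] picks the value there and an arbitrary one elsewhere. *)
  set (V := fun r => epsilon (inhabits 0) (jintegral n (indic (inter_balls n (S m) p r)))).
  assert (HV : forall r, 0 < r -> jintegral n (indic (inter_balls n (S m) p r)) (V r)).
  { intros r Hr. apply epsilon_spec. now apply jintegral_inter_balls. }
  exists delta, (INR n * M0), V. split; [|split; [|split]].
  - now apply jintegral_has_integral.
  - exists (hull_support n m p). split; [intros; apply hull_support_value|].
    apply jintegral_has_integral.
    eapply jintegral_ext; [|exact (jintegral_scal n (INR n) _ _ HM0)].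
    intros x. cbv beta. assert (Hx := norm_nonneg n x).
    destruct excluded_middle_informative as [H|H].
    + rewrite indic_in by (apply ball_zero; lra). f_equal.
      (* By homogeneity h(x/|x|) = h(x)/|x|, so the integrand of the cone formula is n times that of
         [M0]. *)
      replace (fun i => x i / norm n x) with (affine (/ norm n x) zero_vec x)
        by (apply functional_extensionality; intros; unfold affine, zero_vec, Rdiv; ring).
      rewrite hull_support_scal by (apply Rinv_0_lt_compat; lra). unfold Rdiv. ring.
    (* The sphere integrand is set to 0 at norm 0; the quotient agrees with it, since the support
       function vanishes there. *)
    + destruct (Req_dec (norm n x) 0) as [E|E].
      * assert (B := hull_support_bound n m p x). rewrite E, Rmult_0_r in B.
        assert (hull_support n m p x = 0) as -> by (unfold Rabs in B; destruct Rcase_abs; lra).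
        unfold Rdiv. ring.
      * rewrite indic_out by (rewrite ball_zero; lra). ring.
  - intros r Hr. now apply jintegral_has_integral, HV.
  - apply (inter_balls_expansion n m p); auto. lia.
Qed.
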